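(* Let $w:I\to(0,\infty)$ be a decreasing weight on $I=(0,a)$, $0<a\le\infty$, with $W(t)=\int_0^t w\,dm<\infty$ for all $t\in I$. Let $b=\int_I w\,dm\in(0,\infty]$, $J=(0,b)$, and let $E$ be a fully symmetric Banach function space on $J$ with support $J$. Then the Köthe dual of $M_{E,w}$ equals $\Lambda_{E',w}$ isometrically, that is, $(M_{E,w})'=\Lambda_{E',w}$ as sets and $\|f\|_{(M_{E,w})'}=\|f\|_{\Lambda_{E',w}}$.
   Context: $m$ is Lebesgue measure; functions are identified when equal a.e.; ''decreasing'' means non-increasing. $L^0(I)$ is the space of real Lebesgue measurable functions on $I$. For a measure $\mu$ and a $\mu$-measurable $f$ on $\Omega$, $d_f^\mu(s)=\mu\{|f|>s\}$ and $f^{*,\mu}(t)=\inf\{s>0:d_f^\mu(s)\le t\}$ for $0\le t<\mu(\Omega)$; $f^*$ is the rearrangement for $\mu=m$, and $f^{*,w}$ the rearrangement with respect to the measure $w\,dm$ on $I$, a function on $J$. For functions on $J$, $g\prec h$ means $\int_0^x g^*\,dm\le\int_0^x h^*\,dm$ for all $x\in J$. A Banach function space on $J$ is a solid linear subspace $E$ of $L^0(J)$ with full support, complete under a monotone norm ($|f|\le|g|$ a.e. implies $\|f\|_E\le\|g\|_E$). It is fully symmetric if equimeasurable functions have equal norms and $f\prec g$, $f\in L^0(J)$, $g\in E$ imply $f\in E$ and $\|f\|_E\le\|g\|_E$. ''Support $J$'' means $\chi_A\in E$ whenever $m(A)<\infty$. The Köthe dual $E'$ is the set of $f\in L^0(J)$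 with $\|f\|_{E'}=\sup\{\int_J|fg|\,dm:\|g\|_E\le1\}<\infty$. For a fully symmetric space $F$ on $J$ (here $F=E$ or $F=E'$): $F_w=\{f\in L^0(I):f^{*,w}\in F\}$, $\|f\|_{F_w}=\|f^{*,w}\|_F$. The generalized Lorentz space is $\Lambda_{F,w}=\{f\in L^0(I):f^*\in F_w\}$, $\|f\|_{\Lambda_{F,w}}=\|f^*\|_{F_w}$. The class $M_{F,w}=\{f\in L^0(I): f^*/w\in F_w\}$ has gauge $\|f\|_{M_{F,w}}=\|f^*/w\|_{F_w}$. The Köthe dual $(M_{E,w})'$ of the class $M_{E,w}$ (which need not be linear) is the set of $f\in L^0(I)$ such that $\|f\|_{(M_{E,w})'}:=\sup\{\int_I|fg|\,dm: g\in M_{E,w},\ \|g\|_{M_{E,w}}\le1\}<\infty$. *)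

(* Defs.v *)
From HB Require Import structures.
From mathcomp Require Import all_boot all_order all_algebra.
From mathcomp Require Import all_classical all_reals all_analysis.
Import Order.TTheory GRing.Theory Num.Theory.
Import numFieldNormedType.Exports.

Set Implicit Arguments.
Unset Strict Implicit.
Unset Printing Implicit Defensive.

Local Open Scope classical_set_scope.
Local Open Scope ring_scope.

(* A copy of [R] whose measurable sets are the Lebesgue measurable sets
   (see [completed_caratheodory_measurable]), not only the Borel sets. *)
Definition lebR (R : realType) : measurableType _ :=
  caratheodory_type ((@wlength R idfun)^*)%mu.

Definition leb {R : realType} : set (lebR R) -> \bar R :=
  @completed_lebesgue_measure R.
HB.instance Definition _ (R : realType) := Measure.on (@leb R).
HB.instance Definition _ (R : realType) := SigmaFiniteMeasure.on (@leb R).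

(* The open interval from 0 to [a], possibly unbounded. *)
Definition itv0 {R : realType} (a : \bar R) : set (lebR R) :=
  [set x : R | 0 < x /\ (x%:E < a)%E].

(* Functions on [O] are total functions of which only the values on [O]
   matter.  The predicates and gauges below do not separate functions that are
   equal a.e. on [O], so there is no explicit quotient. *)
Definition L0 {R : realType} (O : set (lebR R)) : set (lebR R -> R) :=
  [set f | measurable_fun O f].

Definition distribution {R : realType} (mu : set (lebR R) -> \bar R)
    (O : set (lebR R)) (f : lebR R -> R) (s : R) : \bar R :=
  mu (O `&` [set x | s < `|f x|]).

Definition rearr {R : realType} (mu : set (lebR R) -> \bar R)
    (O : set (lebR R)) (f : lebR R -> R) (t : lebR R) : \bar R :=
  ereal_inf [set s%:E | s in
    [set s : R | 0 < s /\ (distribution mu O f s <= (t : R)%:E)%E]].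

Definition wmeas {R : realType} (w : lebR R -> R) (A : set (lebR R)) : \bar R :=
  (\int[leb]_(x in A) (w x)%:E)%E.

Definition submajorized {R : realType} (O : set (lebR R))
    (f g : lebR R -> R) : Prop :=
  forall x : R, O x ->
    (\int[leb]_(t in `]0%R, x[) rearr leb O f t
      <= \int[leb]_(t in `]0%R, x[) rearr leb O g t)%E.

Definition equimeasurable {R : realType} (O : set (lebR R))
    (f g : lebR R -> R) : Prop :=
  forall s : R, 0 <= s -> distribution leb O f s = distribution leb O g s.

(* A class of functions on [O] with a gauge; the gauge is only meaningful on
   the carrier.  Neither linearity nor a norm is assumed. *)
Record fclass {R : realType} (O : set (lebR R)) := FClass {
  carrier : set (lebR R -> R);
  gauge : (lebR R -> R) -> \bar R }.

(* Membership and gauge of an extended real valued function, such as a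
   rearrangement: it must be finite a.e. on [O] to represent an element
   of [L0 O]. *)
Definition ext_mem {R : realType} {O : set (lebR R)} (X : fclass O)
    (h : lebR R -> \bar R) : Prop :=
  {ae leb, forall t, O t -> h t \is a fin_num} /\ carrier X (fine \o h).

Definition ext_gauge {R : realType} {O : set (lebR R)} (X : fclass O)
    (h : lebR R -> \bar R) : \bar R := gauge X (fine \o h).

Record banach_function_space {R : realType} {O : set (lebR R)}
    (X : fclass O) : Prop := {
  bfs_L0 : carrier X `<=` L0 O;
  bfs_add : forall f g, carrier X f -> carrier X g -> carrier X (f \+ g);
  bfs_scale : forall (c : R) f, carrier X f -> carrier X (fun x => c * f x);
  bfs_solid : forall f g, L0 O f -> carrier X g ->
    {ae leb, forall x, O x -> `|f x| <= `|g x|} -> carrier X f;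
  bfs_full_support : forall A : set (lebR R), measurable A -> A `<=` O ->
    (0 < leb A)%E ->
    exists2 g, carrier X g & ~ {ae leb, forall x, A x -> g x = 0};
  bfs_norm_fin : forall f, carrier X f -> (0 <= gauge X f < +oo)%E;
  bfs_norm_eq0 : forall f, carrier X f -> gauge X f = 0%E ->
    {ae leb, forall x, O x -> f x = 0};
  bfs_normZ : forall (c : R) f, carrier X f ->
    gauge X (fun x => c * f x) = (`|c|%:E * gauge X f)%E;
  bfs_normD : forall f g, carrier X f -> carrier X g ->
    (gauge X (f \+ g)%R <= gauge X f + gauge X g)%E;
  bfs_norm_mono : forall f g, carrier X f -> carrier X g ->
    {ae leb, forall x, O x -> `|f x| <= `|g x|} ->
    (gauge X f <= gauge X g)%E;
  bfs_complete : forall u : nat -> lebR R -> R, (forall n, carrier X (u n)) ->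
    (forall e : R, 0 < e -> exists N : nat, forall m n : nat,
      (N <= m)%N -> (N <= n)%N -> (gauge X (u m \- u n)%R < e%:E)%E) ->
    exists2 f, carrier X f & gauge X (u n \- f)%R @[n --> \oo] --> 0%E }.

Definition has_support {R : realType} {O : set (lebR R)}
    (X : fclass O) : Prop :=
  forall A : set (lebR R), measurable A -> A `<=` O -> (leb A < +oo)%E ->
    carrier X (\1_A : lebR R -> R).

Record fully_symmetric {R : realType} {O : set (lebR R)}
    (X : fclass O) : Prop := {
  fs_equimeasurable : forall f g, carrier X f -> carrier X g ->
    equimeasurable O f g -> gauge X f = gauge X g;
  fs_submajorized : forall f g, L0 O f -> carrier X g -> submajorized O f g ->
    carrier X f /\ (gauge X f <= gauge X g)%E }.

Definition kothe_gauge {R : realType} {O : set (lebR R)} (X : fclass O)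
    (f : lebR R -> R) : \bar R :=
  ereal_sup [set (\int[leb]_(x in O) `|f x * g x|%:E)%E | g in
    [set g | carrier X g /\ (gauge X g <= 1)%E]].

Definition kothe_dual {R : realType} {O : set (lebR R)} (X : fclass O)
    : fclass O :=
  FClass O [set f | L0 O f /\ (kothe_gauge X f < +oo)%E] (kothe_gauge X).

Section WeightedClasses.
Context {R : realType} (I : set (lebR R)) {J : set (lebR R)}.
Variables (F : fclass J) (w : lebR R -> R).

Definition weighted_space : fclass I :=
  FClass I [set f | L0 I f /\ ext_mem F (rearr (wmeas w) I f)]
    (fun f => ext_gauge F (rearr (wmeas w) I f)).

Definition Lorentz_space : fclass I :=
  FClass I [set f | L0 I f /\ ext_mem weighted_space (rearr leb I f)]
    (fun f => ext_gauge weighted_space (rearr leb I f)).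

Definition Mclass : fclass I :=
  let quot f t := (rearr leb I f t * ((w t)^-1)%:E)%E in
  FClass I [set f | L0 I f /\ ext_mem weighted_space (quot f)]
    (fun f => ext_gauge weighted_space (quot f)).

End WeightedClasses.

(* Main.v *)
(* Let mu = w dm, write f^# and f^#w for the decreasing rearrangements of f with
   respect to m and mu, and put W(x) = mu(0, x).  By the layer cake formula,
   integrals of products are governed by the distribution functions through
     overlap p q = int_0^oo int_0^oo min (p s) (q u) du ds :
   int |f g| <= overlap d_f d_g always holds (Hardy-Littlewood), with equality
   when f and g are both decreasing.

   That the Lorentz space lies in the Koethe dual is Hardy-Littlewood applied
   twice, first to f and g for m on I, then to f^# and g^# / w for mu.

   Conversely let h be in the unit ball of E and put k = (h^# o W) w.  This
   function is decreasing, and (k / w)^#w = h^# because W carries mu to m; hence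
   every g with d_g <= d_k is in the unit ball of M_{E,w}.  Such functions g can
   be aligned with the level sets of f, so that int |f g| comes arbitrarily
   close to overlap d_f d_k = int_I f^# k dm, and this number dominates
   int_J (f^#)^#w |h| dm. *)

Require Import Defs.
From HB Require Import structures.
From mathcomp Require Import all_boot all_order all_algebra.
From mathcomp Require Import all_classical all_reals all_analysis.
From mathcomp Require Import measurable_realfun lra.
Import Order.TTheory GRing.Theory Num.Theory.
Import numFieldNormedType.Exports.
Import Defs. (* [all_analysis] has another [distribution]. *)

Local Open Scope classical_set_scope.
Local Open Scope ring_scope.

Set Implicit Arguments.
Unset Strict Implicit.
Unset Printing Implicit Defensive.

(** * Lebesgue measurable sets and monotone functions *)

(** [overlap] needs only two distribution functions and tolerates infinite values, so no product of
    rearrangements has to be formed before finiteness is known. The obstacle is the alignment with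
    f: on a plateau of f a function of f alone cannot reproduce d_k, and superlevel sets of infinite
    mass give infinite ranks. Hence f is replaced by dyadic truncations on bounded windows, indexed
    by integers; a tie-breaking term then makes the rank carry Lebesgue measure to Lebesgue measure,
    and k^# composed with the rank is the required g. A window may have less mass than the support
    of k, so one only gets d_g <= d_k; this suffices, because the unit ball of M_{E,w} is reached by
    domination of distribution functions. Finiteness of the rearrangements is a separate matter:
    membership in the Lorentz space demands it, and for f in the Koethe dual it comes from testing
    against the extremal function of a normalized indicator. *)

Lemma borel_lebR_measurable (R : realType) (A : set R) :
  measurable A -> measurable (A : set (lebR R)).
Proof. exact: sub_caratheodory. Qed.

Lemma lebE (R : realType) (A : set R) :
  leb (A : set (lebR R)) = lebesgue_measure A.
Proof. by []. Qed.

Lemma is_interval_lebR_measurable (R : realType) (A : set R) :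
  is_interval A -> measurable (A : set (lebR R)).
Proof. by move=> iA; apply: borel_lebR_measurable; exact: is_interval_measurable. Qed.

Lemma is_interval_itv0 (R : realType) (c : \bar R) :
  is_interval (itv0 c : set R).
Proof.
move=> x y [x0 xc] [y0 yc] z /andP[xz zy]; split.
  exact: lt_le_trans x0 xz.
by apply: le_lt_trans yc; rewrite lee_fin.
Qed.

Lemma measurable_itv0 (R : realType) (c : \bar R) : measurable (@itv0 R c).
Proof. by apply: is_interval_lebR_measurable; exact: is_interval_itv0. Qed.

Lemma itv0_EFin (R : realType) (c : R) : @itv0 R c%:E = `]0, c[%classic.
Proof.
apply/seteqP; split => x /=; rewrite /itv0/= in_itv/= lte_fin.
  by case=> -> ->.
by case/andP.
Qed.

Lemma itv0_pinfty (R : realType) : @itv0 R +oo%E = `]0, +oo[%classic.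
Proof.
apply/seteqP; split => x /=; rewrite /itv0/= in_itv/= andbT; first by case.
by move=> ?; rewrite ltry.
Qed.

Lemma leb_itv0 (R : realType) (c : \bar R) : (0 <= c)%E -> leb (itv0 c) = c.
Proof.
case: c => [r| |]//; rewrite ?lee_fin.
  rewrite itv0_EFin lebE => r0; rewrite lebesgue_measure_itv/= lte_fin sube0.
  by case: ltP => // r0'; congr EFin; apply/eqP; rewrite eq_le r0.
by rewrite itv0_pinfty lebE lebesgue_measure_itv/= ltry.
Qed.

Lemma itv0_nonempty (R : realType) (c : \bar R) : (0 < c)%E ->
  exists x : R, itv0 c x.
Proof.
case: c => [r| |]//; last by exists 1; split; rewrite ?ltry.
by rewrite lte_fin => r0; exists (r / 2); split; rewrite ?lte_fin; lra.
Qed.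

Lemma borel_lebR_measurable_fun (R : realType) (f : R -> R) :
  measurable_fun setT f -> measurable_fun setT (f : lebR R -> R).
Proof.
move=> mf _ Y mY; rewrite setTI; apply/borel_lebR_measurable.
by rewrite -[X in measurable X]setTI; apply: mf.
Qed.

Lemma measurable_fun_gt d (T : measurableType d) (R : realType) (O : set T)
    (f : T -> R) : measurable O ->
  (forall s, measurable (O `&` [set x | s < f x])) -> measurable_fun O f.
Proof.
move=> mO mf _; apply: (measurability _ (RGenOInfty.measurableE R)) => //.
move=> _ [_ [s ->] <-]; rewrite (_ : f @^-1` _ = [set x | s < f x]) //.
by apply/seteqP; split => x /=; rewrite in_itv/= andbT.
Qed.

Lemma measurable_gt d (T : measurableType d) (R : realType) (O : set T)
    (f : T -> R) s : measurable O -> measurable_fun O f ->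
  measurable (O `&` [set x | s < f x]).
Proof.
move=> mO mf; rewrite (_ : [set x | s < f x] = f @^-1` `]s, +oo[).
  exact: mf.
by apply/seteqP; split => x /=; rewrite in_itv/= andbT.
Qed.

Lemma measurable_abs_gt d (T : measurableType d) (R : realType) (O : set T)
    (f : T -> R) s : measurable O -> measurable_fun O f ->
  measurable (O `&` [set x | s < `|f x|]).
Proof.
move=> mO mf; apply: (@measurable_gt _ _ _ _ (fun x => `|f x|)) => //.
exact: measurableT_comp.
Qed.

Lemma nonincreasing_lebR_measurable (R : realType) (O : set (lebR R))
    (f : lebR R -> R) : is_interval (O : set R) ->
  (forall x y : R, O x -> O y -> x <= y -> f y <= f x) -> measurable_fun O f.
Proof.
move=> iO f_ni; apply: measurable_fun_gt.
  exact: is_interval_lebR_measurable.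
move=> s; apply: is_interval_lebR_measurable => x y [Ox sx] [Oy sy] z /andP[xz zy].
have Oz : O z by apply: (iO x y) => //; rewrite xz zy.
by split => //=; apply: (lt_le_trans sy); apply: f_ni.
Qed.

Lemma nonincreasing_emeasurable (R : realType) (D : set R) (f : R -> \bar R) :
  measurable D -> is_interval D ->
  (forall x y : R, D x -> D y -> x <= y -> (f y <= f x)%E) -> measurable_fun D f.
Proof.
move=> mD iD f_ni _; apply: (measurability _ (ErealGenOInfty.measurableE R)) => //.
move=> _ [_ [r ->] <-]; apply: is_interval_measurable => x y [Dx rx] [Dy ry] z /andP[xz zy].
have Dz : D z by apply: (iD x y) => //; rewrite xz zy.
split => //=; move: ry; rewrite /= !in_itv/= !andbT => ry.
by apply: (lt_le_trans ry); apply: f_ni.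
Qed.

Lemma ni_measurable_itv0y (R : realType) (f : R -> \bar R) :
  (forall s s', 0 < s -> s <= s' -> (f s' <= f s)%E) ->
  measurable_fun (`]0, +oo[%classic : set R) f.
Proof.
move=> fni; apply: nonincreasing_emeasurable => //; first exact: interval_is_interval.
by move=> x y; rewrite /= in_itv/= andbT => x0 _; exact: fni.
Qed.

Lemma le_integral_ni (R : realType) (f g : R -> \bar R) :
  (forall s, 0 < s -> (0 <= f s)%E) ->
  (forall s s', 0 < s -> s <= s' -> (f s' <= f s)%E) ->
  (forall s s', 0 < s -> s <= s' -> (g s' <= g s)%E) ->
  (forall s, 0 < s -> (f s <= g s)%E) ->
  (\int[lebesgue_measure]_(s in `]0%R, +oo[) f s <=
   \int[lebesgue_measure]_(s in `]0%R, +oo[) g s)%E.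
Proof.
move=> f0 fni gni fg; apply: ge0_le_integral => //.
- by move=> x; rewrite /= in_itv/= andbT; exact: f0.
- exact: ni_measurable_itv0y.
- exact: ni_measurable_itv0y.
- by move=> x; rewrite /= in_itv/= andbT; exact: fg.
Qed.

(** Monotonicity in each variable makes the integrand measurable in u and its inner integral
    monotone, hence measurable, in s. Iterated integrals can thus be compared without joint
    measurability. *)
Definition ni2 {R : realType} (F : R -> R -> \bar R) :=
  [/\ forall s u, 0 < s -> 0 < u -> (0 <= F s u)%E,
      forall s s' u, 0 < s -> s <= s' -> 0 < u -> (F s' u <= F s u)%E &
      forall s u u', 0 < s -> 0 < u -> u <= u' -> (F s u' <= F s u)%E].

Lemma ni2_integral (R : realType) (F : R -> R -> \bar R) : ni2 F ->
  forall s s', 0 < s -> s <= s' ->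
  (\int[lebesgue_measure]_(u in `]0%R, +oo[) F s' u <=
   \int[lebesgue_measure]_(u in `]0%R, +oo[) F s u)%E.
Proof.
move=> [F0 Fs Fu] s s' s0 ss'; have s'0 := lt_le_trans s0 ss'.
apply: le_integral_ni => // u *; first exact: F0.
- exact: Fu.
- exact: Fu.
- exact: Fs.
Qed.

Lemma le_integral_ni2 (R : realType) (F G : R -> R -> \bar R) :
  ni2 F -> ni2 G ->
  (forall s u, 0 < s -> 0 < u -> (F s u <= G s u)%E) ->
  (\int[lebesgue_measure]_(s in `]0%R, +oo[)
     \int[lebesgue_measure]_(u in `]0%R, +oo[) F s u <=
   \int[lebesgue_measure]_(s in `]0%R, +oo[)
     \int[lebesgue_measure]_(u in `]0%R, +oo[) G s u)%E.
Proof.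
move=> nF nG FG; apply: le_integral_ni.
- move=> s s0; apply: integral_ge0 => u; rewrite /= in_itv/= andbT.
  by case: nF => F0 _ _; exact: F0.
- exact: ni2_integral.
- exact: ni2_integral.
case: nF nG => F0 Fs Fu [G0 Gs Gu] s s0.
apply: le_integral_ni => u *; [exact: F0|exact: Fu|exact: Gu|exact: FG].
Qed.

Lemma ni2_mine (R : realType) (p q : R -> \bar R) :
  (forall s, 0 < s -> (0 <= p s)%E) -> (forall s, 0 < s -> (0 <= q s)%E) ->
  (forall s s', 0 < s -> s <= s' -> (p s' <= p s)%E) ->
  (forall s s', 0 < s -> s <= s' -> (q s' <= q s)%E) ->
  ni2 (fun s u => mine (p s) (q u)).
Proof.
move=> p0 q0 pni qni; split.
- by move=> s u s0 u0; rewrite le_min p0// q0.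
- by move=> s s' u s0 ss' u0; rewrite le_min !ge_min pni//= lexx orbT.
- by move=> s u u' s0 u0 uu'; rewrite le_min !ge_min qni//= lexx orbT.
Qed.

(** * The layer cake formula *)

Section density.
Context d (T : measurableType d) (R : realType) (mu : {measure set T -> \bar R}).
Context (v : T -> \bar R) (v0 : forall x, (0 <= v x)%E)
  (mv : measurable_fun setT v).

(** The two proofs are arguments so that a measure structure can be attached to [density v0 mv]. *)
Definition density (_ : forall x, (0 <= v x)%E) (_ : measurable_fun setT v)
  (A : set T) : \bar R := (\int[mu]_(x in A) v x)%E.

Let density0 : density v0 mv set0 = 0%E.
Proof. by rewrite /density integral_set0. Qed.

Let density_ge0 A : (0 <= density v0 mv A)%E.
Proof. by rewrite /density integral_ge0. Qed.

Let density_sigma_additive : semi_sigma_additive (density v0 mv).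
Proof.
move=> F mF tF mUF; rewrite /density ge0_integral_bigcup//; last first.
  exact: measurable_funTS.
by apply: is_cvg_ereal_nneg_natsum_cond => n _ _; exact: integral_ge0.
Qed.

HB.instance Definition _ := isMeasure.Build _ _ _ (density v0 mv)
  density0 density_ge0 density_sigma_additive.

End density.

(** For p = d_f and q = d_g this is the integral of f^# g^#: the superlevel sets of the
    rearrangements are intervals starting at 0, and two of them meet in the shorter one. *)
Definition overlap {R : realType} (p q : R -> \bar R) : \bar R :=
  (\int[lebesgue_measure]_(s in `]0%R, +oo[)
     \int[lebesgue_measure]_(u in `]0%R, +oo[) mine (p s) (q u))%E.

Lemma eq_overlap (R : realType) (p p' q q' : R -> \bar R) :
  (forall s, 0 < s -> p s = p' s) -> (forall s, 0 < s -> q s = q' s) ->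
  overlap p q = overlap p' q'.
Proof.
move=> pp qq; apply: eq_integral => s; rewrite inE/= in_itv/= andbT => s0.
apply: eq_integral => u; rewrite inE/= in_itv/= andbT => u0.
by rewrite pp// qq.
Qed.

(** Tonelli for v on the region 0 < s < |f x|, after extending f and v by 0 outside O: integrating
    in s first gives |f x| v x, integrating in x first gives the superlevel sets. *)
Lemma layer_cake d (T : measurableType d) (R : realType)
    (mu : {sigma_finite_measure set T -> \bar R}) (O : set T) (f : T -> R)
    (v : T -> \bar R) :
  measurable O -> measurable_fun O f -> measurable_fun O v ->
  (forall x, O x -> (0 <= v x)%E) ->
  (\int[mu]_(x in O) (`|f x|%:E * v x) =
   \int[lebesgue_measure]_(s in `]0%R, +oo[)
      \int[mu]_(x in O `&` [set x | s < `|f x|]%R) v x)%E.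
Proof.
move=> mO mf mv v0.
pose f0 := (fun x => `|f x|) \_ O; pose v1 := v \_ O.
have mf0 : measurable_fun setT f0.
  by apply/(measurable_restrictT _ mO); exact: measurableT_comp.
have mv1 : measurable_fun setT v1 by apply/(measurable_restrictT _ mO).
have v10 x : (0 <= v1 x)%E by apply: erestrict_ge0.
pose S : set (T * R) := [set z | 0 < z.2] `&` [set z | z.2 < f0 z.1].
have mS : measurable S.
  have m1 : measurable_fun setT (fun z : T * R => 0 < z.2) by apply: measurable_fun_ltr.
  have m2 : measurable_fun setT (fun z : T * R => z.2 < f0 z.1).
    by apply: measurable_fun_ltr => //; exact: measurableT_comp.
  apply: measurableI.
    rewrite -[X in measurable X]setTI.
    rewrite (_ : [set z | _] = (fun z => 0 < z.2) @^-1` [set true])//.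
    exact: m1.
  rewrite -[X in measurable X]setTI.
  rewrite (_ : [set z | _] = (fun z => z.2 < f0 z.1) @^-1` [set true])//.
  exact: m2.
pose F : T * R -> \bar R := (v1 \o fst) \_ S.
have mF : measurable_fun setT F.
  by apply/(measurable_restrictT _ mS)/measurable_funTS; exact: measurableT_comp.
have F0 z : (0 <= F z)%E by rewrite /F patchE; case: ifP => _ //=.
have E := @fubini_tonelli _ _ _ _ _ mu (@lebesgue_measure R) F mF F0.
rewrite [LHS]integral_mkcond [RHS]integral_mkcond.
transitivity (\int[mu]_x \int[lebesgue_measure]_y F (x, y))%E.
  apply: eq_integral => x _; rewrite /F.
  transitivity (\int[lebesgue_measure]_(y in `]0%R, (f0 x)[) v1 x)%E.
    rewrite integral_cst//= lebesgue_measure_itv/= lte_fin sube0.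
    rewrite /f0 /v1 !patchE; case: ifPn => xO; last by rewrite mul0e.
    rewrite muleC; case: ltP => // fx; congr (_ * _)%E.
    by apply/eqP; rewrite eqe eq_le fx /=.
  rewrite integral_mkcond; apply: eq_integral => y _.
  rewrite !patchE; congr (if _ then _ else _); apply/idP/idP; rewrite !inE /S/= in_itv/=.
    by case/andP.
  by case=> -> ->.
rewrite E; apply: eq_integral => s _; rewrite [RHS]patchE.
rewrite /F; case: ifPn; rewrite ?inE ?notin_setE/= in_itv/= andbT => s0.
  rewrite [RHS]integral_mkcond; apply: eq_integral => x _.
  rewrite !patchE/=; case: ifPn => [|]; rewrite ?inE ?notin_setE /S /= => h.
    have xO : x \in O.
      case: (h) => s0'; rewrite /f0 patchE; case: ifPn => // _ s0''.
      by have := lt_trans s0' s0''; rewrite ltxx.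
    rewrite /v1 patchE xO ifT // inE; split; first by rewrite -in_setE.
    by case: h => _; rewrite /f0 patchE xO.
  case: ifPn => //; rewrite inE => -[Ox sx]; exfalso; apply: h; split => //.
  by rewrite /f0 patchE mem_set.
rewrite integral0_eq// => x _; rewrite patchE ifF//; apply/negP; rewrite inE => -[/= ]; lra.
Qed.

(** * Rearrangements *)

Lemma distribution_ni (R : realType) (mu : {measure set (lebR R) -> \bar R})
    (O : set (lebR R)) (f : lebR R -> R) (s s' : R) :
  measurable O -> L0 O f -> s <= s' ->
  (distribution mu O f s' <= distribution mu O f s)%E.
Proof.
move=> mO mf ss'; apply: le_measure; rewrite ?inE; try exact: measurable_abs_gt.
by move=> x [Ox /= s'x]; split => //=; exact: le_lt_trans s'x.
Qed.

Lemma le_rearr (R : realType) (mu mu' : set (lebR R) -> \bar R)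
    (O O' : set (lebR R)) (f g : lebR R -> R) (t : lebR R) :
  (forall s, 0 < s ->
    (distribution mu O f s <= distribution mu' O' g s)%E) ->
  (rearr mu O f t <= rearr mu' O' g t)%E.
Proof.
move=> fg; apply/ereal_infP => _ [s [s0 gs] <-]; apply: ereal_inf_lbound.
exists s => //; split => //; exact: le_trans (fg _ s0) gs.
Qed.

Lemma eq_rearr (R : realType) (mu mu' : set (lebR R) -> \bar R)
    (O O' : set (lebR R)) (f g : lebR R -> R) :
  (forall s, 0 < s -> distribution mu O f s = distribution mu' O' g s) ->
  rearr mu O f = rearr mu' O' g.
Proof.
move=> fg; apply/funext => t; apply/eqP; rewrite eq_le.
by rewrite !le_rearr// => s s0; rewrite fg.
Qed.

Lemma rearr_ge0 (R : realType) (mu : set (lebR R) -> \bar R)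
    (O : set (lebR R)) (f : lebR R -> R) t : (0 <= rearr mu O f t)%E.
Proof. by apply/ereal_infP => _ [s [s0 _] <-]; rewrite lee_fin ltW. Qed.

Lemma rearr_ni (R : realType) (mu : set (lebR R) -> \bar R)
    (O : set (lebR R)) (f : lebR R -> R) (t t' : R) : t <= t' ->
  (rearr mu O f t' <= rearr mu O f t)%E.
Proof.
move=> tt'; apply/ereal_infP => _ [s [s0 ds] <-]; apply: ereal_inf_lbound.
by exists s => //; split => //; apply: le_trans ds _; rewrite lee_fin.
Qed.

(** The strict form of this duality rests on right continuity of the distribution function: if it
    exceeds t at s, continuity from below makes it exceed t at s + 1/(n+1) for some n. *)
Lemma rearr_gt (R : realType) (mu : {measure set (lebR R) -> \bar R})
    (O : set (lebR R)) (f : lebR R -> R) (s t : R) :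
  measurable O -> L0 O f -> 0 <= s ->
  (s%:E < rearr mu O f t)%E = (t%:E < distribution mu O f s)%E.
Proof.
move=> mO mf s0; apply/idP/idP; last first.
  move=> tds.
  have [n tn] : exists n : nat, (t%:E < distribution mu O f (s + n.+1%:R^-1))%E.
    apply: contrapT => /forallNP h.
    have : (distribution mu O f s <= t%:E)%E.
      pose F n := O `&` [set x | s + n.+1%:R^-1 < `|f x|].
      have mF n : measurable (F n) by exact: measurable_abs_gt.
      have EF : O `&` [set x | s < `|f x|] = \bigcup_n F n.
        apply/seteqP; split => [x [Ox /= sx]|x [n _ [Ox /= snx]]].
          have e0 : 0 < `|f x| - s by rewrite subr_gt0.
          have [n hn] := ltr_add_invr sx.
          by exists n => //; split.
        by split => //=; apply: lt_trans snx; rewrite ltrDl invr_gt0.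
      rewrite /distribution EF.
      have cF : (mu \o F) x @[x --> \oo] --> mu (\bigcup_n F n).
        apply: nondecreasing_cvg_mu => //; first exact: bigcupT_measurable.
        move=> m n mn; apply/subsetPset => x [Ox /= mx]; split => //=.
        by apply: le_lt_trans mx; rewrite lerD2l lef_pV2 ?posrE// ler_nat.
      rewrite -(cvg_lim _ cF)//; apply: lime_le; first by apply/cvg_ex; eexists; exact: cF.
      by apply: nearW => n /=; rewrite leNgt; apply/negP/h.
    by rewrite leNgt tds.
  apply: (@lt_le_trans _ _ (s + n.+1%:R^-1)%:E); first by rewrite lte_fin ltrDl invr_gt0.
  apply/ereal_infP => _ [r [r0 dr] <-]; rewrite lee_fin leNgt; apply/negP => rs.
  have := lt_le_trans tn (le_trans (distribution_ni mu mO mf (ltW rs)) dr).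
  by rewrite ltxx.
apply: contraLR; rewrite -!leNgt => dst; apply/lee_addgt0Pr => e e0.
(* The infimum ranges over positive levels only and s may be 0, hence the shift by e. *)
apply: ereal_inf_lbound; exists (s + e) => //=; split; first by rewrite ltr_wpDl.
by apply: le_trans dst; apply: distribution_ni => //; rewrite lerDl ltW.
Qed.

Lemma rearr_lty_distribution (R : realType) (mu : set (lebR R) -> \bar R)
    (O : set (lebR R)) (f : lebR R -> R) t : rearr mu O f t \is a fin_num ->
  exists2 s : R, 0 < s & (distribution mu O f s < +oo)%E.
Proof.
rewrite ge0_fin_numE; last exact: rearr_ge0.
move=> /ereal_inf_lt[_ [s [s0 ds] <-] _]; exists s => //.
by apply: le_lt_trans ds _; rewrite ltry.
Qed.

(** The sets where |f| > s + n decrease to the empty set and the first has finite mass, so the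
    distribution function tends to 0 and eventually drops below any t > 0. *)
Lemma rearr_fin_num (R : realType) (mu : {measure set (lebR R) -> \bar R})
    (O : set (lebR R)) (f : lebR R -> R) (s t : R) :
  measurable O -> L0 O f -> (distribution mu O f s < +oo)%E -> 0 < t ->
  rearr mu O f t \is a fin_num.
Proof.
move=> mO mf ds t0; rewrite ge0_fin_numE; last exact: rearr_ge0.
pose F n := O `&` [set x | s + n%:R < `|f x|].
have mF n : measurable (F n) by exact: measurable_abs_gt.
have F0 : \bigcap_n F n = set0.
  apply/seteqP; split => // x Fx.
  have [n hn] : exists n : nat, `|f x| - s < n%:R.
    by exists (Num.truncn (`|f x| - s)).+1; exact: truncnS_gt.
  have := (Fx n I).2 => /=; lra.
have : (mu \o F) x @[x --> \oo] --> mu (\bigcap_n F n).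
  apply: nonincreasing_cvg_mu => //.
  - by rewrite /F addr0.
  - exact: bigcapT_measurable.
  move=> m n mn; apply/subsetPset => x [Ox /= mx]; split => //=.
  by apply: le_lt_trans mx; rewrite lerD2l ler_nat.
rewrite F0 measure0 => cF.
have [n Fnt] : exists n, (mu (F n) <= t%:E)%E.
  apply: contrapT => /forallNP h.
  have : (t%:E <= 0)%E.
    rewrite -(cvg_lim _ cF)//; apply: lime_ge; first by apply/cvg_ex; eexists; exact: cF.
    by apply: nearW => n /=; rewrite ltW// ltNge; apply/negP/h.
  by rewrite lee_fin leNgt t0.
apply: (@le_lt_trans _ _ (`|s| + n%:R + 1)%:E); last exact: ltry.
apply: ereal_inf_lbound; exists (`|s| + n%:R + 1) => //=; split.
  by rewrite ltr_wpDl// addr_ge0.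
apply: le_trans Fnt; apply: distribution_ni => //.
by have := ler_norm s; lra.
Qed.

Lemma ae_itv0_exists (R : realType) (c : \bar R) (P : lebR R -> Prop) :
  (0 < c)%E -> {ae leb, forall t, itv0 c t -> P t} -> exists2 t, itv0 c t & P t.
Proof.
move=> c0 [N [mN N0 hN]]; apply: contrapT => h.
have : (leb (itv0 c) <= leb N)%E.
  apply: le_measure; rewrite ?inE//; first exact: measurable_itv0.
  by move=> t ct; apply: hN => /= /(_ ct) Pt; apply: h; exists t.
rewrite leb_itv0; last exact: ltW.
by move=> cN; have := lt_le_trans c0 cN; rewrite [leb N]N0 ltxx.
Qed.

(** One finite value of the rearrangement provides a level of finite mass, which also controls
    smaller arguments. The a.e. finiteness in [ext_mem] thereby becomes finiteness at every positive
    argument. *)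
Lemma rearr_fin_num_transfer (R : realType) (mu : {measure set (lebR R) -> \bar R})
    (O : set (lebR R)) (f : lebR R -> R) (t : R) :
  measurable O -> L0 O f -> rearr mu O f t \is a fin_num ->
  forall t' : R, 0 < t' -> rearr mu O f t' \is a fin_num.
Proof.
move=> mO mf Ft; have [s s0 ds] := rearr_lty_distribution Ft.
by move=> t'; exact: rearr_fin_num ds.
Qed.

(** By [rearr_gt] the superlevel set of the rearrangement at s is the interval from 0 to d_f(s),
    which fits into the interval from 0 to b because mu O = b. *)
Lemma distribution_fine_rearr (R : realType)
    (mu : {measure set (lebR R) -> \bar R}) (O : set (lebR R))
    (f : lebR R -> R) (b : \bar R) (s : R) :
  measurable O -> L0 O f -> mu O = b ->
  (forall t : R, 0 < t -> rearr mu O f t \is a fin_num) -> 0 <= s ->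
  distribution leb (itv0 b) (fine \o rearr mu O f) s = distribution mu O f s.
Proof.
move=> mO mf muO finf s0.
have dsb : (distribution mu O f s <= b)%E.
  by rewrite -muO; apply: le_measure; rewrite ?inE//; exact: measurable_abs_gt.
rewrite /distribution -/(distribution mu O f s) (_ : _ `&` _ = itv0 (distribution mu O f s)).
  by rewrite leb_itv0//; exact: measure_ge0.
have gtE (t : R) : 0 < t ->
    (s < `|(fine \o rearr mu O f) t|) = (t%:E < distribution mu O f s)%E.
  move=> t0; rewrite -rearr_gt//= ger0_norm; last exact/fine_ge0/rearr_ge0.
  by rewrite -lte_fin fineK// finf.
apply/seteqP; split => [t [[t0 tb] /= st]|t [t0 tds]].
  by split => //; rewrite -gtE.
split; last by rewrite /= gtE.
by split => //; exact: lt_le_trans dsb.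
Qed.

Lemma L0_fine_rearr (R : realType) (mu : {measure set (lebR R) -> \bar R})
    (O : set (lebR R)) (f : lebR R -> R) (b : \bar R) :
  (forall t : R, 0 < t -> rearr mu O f t \is a fin_num) ->
  L0 (itv0 b) (fine \o rearr mu O f).
Proof.
move=> finf; apply: nonincreasing_lebR_measurable; first exact: is_interval_itv0.
move=> x y [x0 _] [y0 _] xy; rewrite /= fine_le ?finf//.
exact: rearr_ni.
Qed.

Lemma wmeas1 (R : realType) (A : set (lebR R)) : measurable A ->
  wmeas (cst 1) A = leb A.
Proof.
move=> mA; transitivity (\int[leb]_(x in A) cst 1%E x)%E => //.
by rewrite integral_cst// mul1e.
Qed.

Lemma distribution_wmeas1 (R : realType) (O : set (lebR R)) (f : lebR R -> R) :
  measurable O -> L0 O f ->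
  distribution (wmeas (cst 1)) O f = distribution leb O f.
Proof.
move=> mO mf; apply/funext => s; apply: wmeas1; exact: measurable_abs_gt.
Qed.

Lemma L0_norm (R : realType) (O : set (lebR R)) (f : lebR R -> R) :
  L0 O f -> L0 O (fun x => `|f x|).
Proof. by move=> mf; apply: measurableT_comp. Qed.

Lemma L0_add (R : realType) (O : set (lebR R)) (f g : lebR R -> R) :
  L0 O f -> L0 O g -> L0 O (fun x => f x + g x).
Proof. exact: (@measurable_funD _ (lebR R) R O f g). Qed.

Lemma L0_mul (R : realType) (O : set (lebR R)) (f g : lebR R -> R) :
  L0 O f -> L0 O g -> L0 O (fun x => f x * g x).
Proof. exact: (@measurable_funM _ (lebR R) R O f g). Qed.

Lemma le_leb_integral (R : realType) (O : set (lebR R)) (f g : lebR R -> R) :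
  measurable O -> L0 O f -> L0 O g -> (forall x, O x -> 0 <= f x) ->
  (forall x, O x -> f x <= g x) ->
  (\int[leb]_(x in O) (f x)%:E <= \int[leb]_(x in O) (g x)%:E)%E.
Proof.
move=> mO /measurable_EFinP mf /measurable_EFinP mg f0 fg.
apply: (@ge0_le_integral _ (lebR R) R leb O mO _ _ _ mf mg).
  by move=> x Ox; rewrite lee_fin f0.
by move=> x Ox; rewrite lee_fin fg.
Qed.

Lemma leb_layer_cake (R : realType) (O : set (lebR R)) (f v : lebR R -> R) :
  measurable O -> L0 O f -> L0 O v -> (forall x, O x -> 0 <= v x) ->
  (\int[leb]_(x in O) (`|f x| * v x)%:E =
   \int[lebesgue_measure]_(s in `]0%R, +oo[)
      \int[leb]_(x in O `&` [set x | s < `|f x|]%R) (v x)%:E)%E.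
Proof.
move=> mO mf mv v0; rewrite -(@layer_cake _ _ R leb O f (EFin \o v))//.
exact/measurable_EFinP.
Qed.

(** * The Hardy-Littlewood inequality and its equality case *)

Section overlap_integral.
Context (R : realType) (O : set (lebR R)) (w f g : lebR R -> R).
Context (mO : measurable O) (mf : L0 O f) (mg : L0 O g) (mw : L0 O w).
Context (w0 : forall x, O x -> 0 <= w x).

Let lvl s u : set (lebR R) :=
  (O `&` [set x | s < `|f x|]) `&` [set x | u < `|g x|].

Let mlvl s u : measurable (lvl s u).
Proof.
apply: measurable_abs_gt; first exact: measurable_abs_gt.
by apply: measurable_funS mg => //; exact: subIsetl.
Qed.

Let lvlO s u : lvl s u `<=` O. Proof. by move=> x [[]]. Qed.

Let le_wmeas (A B : set (lebR R)) : measurable A -> measurable B ->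
  A `<=` B -> B `<=` O -> (wmeas w A <= wmeas w B)%E.
Proof.
move=> mA mB AB BO.
have mwB : measurable_fun B (EFin \o w).
  by apply/measurable_EFinP; exact: (measurable_funS mO BO mw).
apply: (@ge0_subset_integral _ _ _ leb A B mA mB _ mwB) => //.
by move=> x /BO Ox; rewrite lee_fin w0.
Qed.

Let dist_ni (h : lebR R -> R) s u : L0 O h -> s <= u ->
  (distribution (wmeas w) O h u <= distribution (wmeas w) O h s)%E.
Proof.
move=> mh su; apply: le_wmeas; try exact: measurable_abs_gt.
  by move=> x [Ox /= ux]; split => //=; exact: le_lt_trans ux.
exact: subIsetl.
Qed.

Lemma double_layer_cake :
  (\int[leb]_(x in O) (`|f x| * (`|g x| * w x))%:E =
   \int[lebesgue_measure]_(s in `]0%R, +oo[)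
     \int[lebesgue_measure]_(u in `]0%R, +oo[) wmeas w (lvl s u))%E.
Proof.
have mgw : L0 O (fun x => `|g x| * w x).
  by apply: L0_mul mw; exact: L0_norm.
rewrite leb_layer_cake//; last by move=> x Ox; rewrite mulr_ge0// w0.
apply: eq_integral => s _; rewrite leb_layer_cake//.
- exact: measurable_abs_gt.
- by apply: (measurable_funS mO _ mg); exact: subIsetl.
- by apply: (measurable_funS mO _ mw); exact: subIsetl.
- by move=> x [Ox _]; exact: w0.
Qed.

Lemma hardy_littlewood :
  (\int[leb]_(x in O) (`|f x| * (`|g x| * w x))%:E <=
   overlap (distribution (wmeas w) O f) (distribution (wmeas w) O g))%E.
Proof.
rewrite double_layer_cake; apply: le_integral_ni2.
- split.
  + by move=> s u _ _; apply: integral_ge0 => x /lvlO; rewrite lee_fin; exact: w0.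
  + move=> s s' u _ ss' _; apply: le_wmeas => //.
    by move=> x [[Ox fx] gx]; split => //; split => //; exact: le_lt_trans fx.
  + move=> s u u' _ _ uu'; apply: le_wmeas => //.
    by move=> x [fx gx]; split => //; exact: le_lt_trans gx.
- apply: ni2_mine => [s _|s _|s s' _|s s' _]; try exact: dist_ni.
  + by apply: integral_ge0 => x [Ox _]; rewrite lee_fin; exact: w0.
  + by apply: integral_ge0 => x [Ox _]; rewrite lee_fin; exact: w0.
- move=> s u _ _; rewrite le_min; apply/andP; split.
    apply: le_wmeas => //; first exact: measurable_abs_gt.
    by move=> x [].
  apply: le_wmeas => //; first exact: measurable_abs_gt.
  by move=> x [[Ox _] gx].
Qed.

(** When one of two superlevel sets contains the other, their intersection is the smaller one, so
    the bound behind [hardy_littlewood] is attained at every pair of levels. *)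
Lemma integral_overlap :
  (forall s u, [set x | O x /\ s < `|f x|] `<=` [set x | u < `|g x|] \/
               [set x | O x /\ u < `|g x|] `<=` [set x | s < `|f x|]) ->
  (\int[leb]_(x in O) (`|f x| * (`|g x| * w x))%:E =
   overlap (distribution (wmeas w) O f) (distribution (wmeas w) O g))%E.
Proof.
move=> nested; rewrite double_layer_cake; apply: eq_integral => s _.
apply: eq_integral => u _; case: (nested s u) => h.
  rewrite (_ : lvl s u = O `&` [set x | s < `|f x|]); last first.
    by apply: setIidl => x [Ox fx]; exact: h.
  apply/esym/min_idPl; apply: le_wmeas; try exact: measurable_abs_gt.
    by move=> x [Ox fx]; split => //; exact: h.
  by move=> x [].
rewrite (_ : lvl s u = O `&` [set x | u < `|g x|]); last first.
  apply/seteqP; split => x; first by case=> [[]].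
  by case=> Ox gx; split => //; split => //; exact: h.
apply/esym/min_idPr; apply: le_wmeas; try exact: measurable_abs_gt.
  by move=> x [Ox fx]; split => //; exact: h.
by move=> x [].
Qed.

End overlap_integral.

Lemma nonincreasing_nested (R : realType) (O : set R) (f g : R -> R) :
  (forall x, O x -> 0 <= f x) -> (forall x, O x -> 0 <= g x) ->
  (forall x y : R, O x -> O y -> x <= y -> f y <= f x) ->
  (forall x y : R, O x -> O y -> x <= y -> g y <= g x) ->
  forall s u, [set x | O x /\ s < `|f x|] `<=` [set x | u < `|g x|] \/
              [set x | O x /\ u < `|g x|] `<=` [set x | s < `|f x|].
Proof.
move=> f0 g0 nf ng s u; apply: contrapT => /not_orP[/existsNP[x /not_implyP[[Ox sx] /= ux]]].
move=> /existsNP[y /not_implyP[[Oy uy] /= sy]].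
move: ux sy sx uy; rewrite !ger0_norm ?f0 ?g0// => /negP ux /negP sy sx uy.
have [xy|/ltW yx] := leP x y.
  by have := lt_le_trans uy (ng _ _ Ox Oy xy); rewrite (negbTE ux).
by have := lt_le_trans sx (nf _ _ Oy Ox yx); rewrite (negbTE sy).
Qed.

Lemma leb_double_layer_cake (R : realType) (O : set (lebR R))
    (f g : lebR R -> R) : measurable O -> L0 O f -> L0 O g ->
  (\int[leb]_(x in O) `|f x * g x|%:E =
   \int[lebesgue_measure]_(s in `]0%R, +oo[)
     \int[lebesgue_measure]_(u in `]0%R, +oo[)
       leb ((O `&` [set x | s < `|f x|]%R) `&` [set x | u < `|g x|]%R))%E.
Proof.
move=> mO mf mg.
have m1 : L0 O (cst 1) by exact: measurable_cst.
rewrite (_ : (\int[leb]_(x in O) `|f x * g x|%:E =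
  \int[leb]_(x in O) (`|f x| * (`|g x| * cst 1 x))%:E)%E); last first.
  by apply: eq_integral => x _; rewrite normrM mulr1.
apply: etrans (double_layer_cake mO mf mg m1 (fun x _ => ler01)) _.
apply: eq_integral => s _; apply: eq_integral => u _; rewrite wmeas1//.
apply: measurable_abs_gt; first exact: measurable_abs_gt.
by apply: (measurable_funS mO _ mg); exact: subIsetl.
Qed.

Lemma hardy_littlewood_leb (R : realType) (O : set (lebR R)) (f g : lebR R -> R) :
  measurable O -> L0 O f -> L0 O g ->
  (\int[leb]_(x in O) `|f x * g x|%:E <=
   overlap (distribution leb O f) (distribution leb O g))%E.
Proof.
move=> mO mf mg; rewrite -!distribution_wmeas1//.
have m1 : L0 O (cst 1) by exact: measurable_cst.
rewrite (_ : (\int[leb]_(x in O) `|f x * g x|%:E =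
  \int[leb]_(x in O) (`|f x| * (`|g x| * cst 1 x))%:E)%E).
  exact: hardy_littlewood.
by apply: eq_integral => x _; rewrite normrM mulr1.
Qed.

Lemma integral_overlap_leb (R : realType) (O : set (lebR R)) (f g : lebR R -> R) :
  measurable O -> L0 O f -> L0 O g ->
  (forall s u, [set x | O x /\ s < `|f x|] `<=` [set x | u < `|g x|] \/
               [set x | O x /\ u < `|g x|] `<=` [set x | s < `|f x|]) ->
  (\int[leb]_(x in O) `|f x * g x|%:E =
   overlap (distribution leb O f) (distribution leb O g))%E.
Proof.
move=> mO mf mg nested; rewrite -!distribution_wmeas1//.
have m1 : L0 O (cst 1) by exact: measurable_cst.
rewrite (_ : (\int[leb]_(x in O) `|f x * g x|%:E =
  \int[leb]_(x in O) (`|f x| * (`|g x| * cst 1 x))%:E)%E).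
  exact: integral_overlap.
by apply: eq_integral => x _; rewrite normrM mulr1.
Qed.

(** * Uniformization of an atomless measure *)

(** Without a minimum, below each y in S lies another z in S and a rational q between them. Choosing
    for every rational an element of S below it, if there is one, and taking running minima gives
    the sequence. It reduces arbitrary families of superlevel sets to countable ones. *)
Lemma coinitial_sequence (R : realType) (S : set R) : S !=set0 ->
  exists u : nat -> R, [/\ forall n, S (u n),
    forall m n, (m <= n)%N -> u n <= u m &
    forall y, S y -> exists n, u n <= y].
Proof.
move=> [x0 Sx0].
have [[m Sm mS]|nomin] := pselect (exists2 m, S m & lbound S m).
  by exists (fun=> m); split => // y /mS; exists 0%N.
have step q : exists x, S x /\ ((exists2 z, S z & z < q) -> x < q).
  have [[z Sz zq]|h] := pselect (exists2 z, S z & z < q); first by exists z.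
  by exists x0.
have /choice[w wS] := step.
(* Indices that code no rational repeat the choice made for 0. *)
pose v n := w (if unpickle n is Some q then ratr (q : rat) else 0).
pose u := nat_rect (fun=> R) x0 (fun n m => Num.min m (v n)).
have Sv n : S (v n) by exact: (wS _).1.
have Su n : S (u n).
  by elim: n => //= n Sun; rewrite /Num.min; case: ifP.
exists u; split => //.
  move=> m n; elim: n => [|n ih]; first by rewrite leqn0 => /eqP ->.
  rewrite leq_eqVlt => /predU1P[->//|]; rewrite ltnS => /ih; apply: le_trans.
  by rewrite /= ge_min lexx.
move=> y Sy.
have [z Sz zy] : exists2 z, S z & z < y.
  apply: contrapT => h; apply: nomin; exists y => // z Sz.
  by rewrite leNgt; apply/negP => zy; apply: h; exists z.
have [q /andP[]] := rat_in_itvoo zy; rewrite !bnd_simp => zq qy.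
(* The term of index n + 1 is the first one that takes [v n] into account. *)
exists (pickle q).+1; rewrite /= ge_min; apply/orP; right.
rewrite /v pickleK; apply/ltW/(lt_trans _ qy)/(wS _).2.
by exists z.
Qed.

Section uniformization.
Context d (T : measurableType d) (R : realType) (nu : {measure set T -> \bar R}).
Context (B : set T) (psi : T -> R).
Context (mB : measurable B) (mpsi : measurable_fun B psi).

(* The rank of [x] when the points of [B] are listed by decreasing [psi]; if no
   level set of [psi] is charged, it carries [nu] to the Lebesgue measure on the
   interval from [0] to [nu B]. *)
Definition upper_mass (x : T) : \bar R := nu (B `&` [set y | psi x < psi y]).

(** No threshold is named, so that strict and non-strict superlevel sets of [psi], sublevel sets of
    the rank and superlevel sets of functions ordered like [psi] are all covered; any two of them
    are nested. *)
Definition upward (A : set T) :=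
  A `<=` B /\ forall x y, A x -> B y -> psi x <= psi y -> A y.

Lemma upward_nested A A' : upward A -> upward A' -> A `<=` A' \/ A' `<=` A.
Proof.
move=> [AB uA] [A'B uA']; apply: contrapT => /not_orP[].
move=> /existsNP[x /not_implyP[Ax A'x]] /existsNP[y /not_implyP[A'y Ay]].
have [xy|/ltW yx] := leP (psi x) (psi y).
  by apply: Ay; apply: (uA x) => //; exact: A'B.
by apply: A'x; apply: (uA' y) => //; exact: AB.
Qed.

Let mge c : measurable (B `&` [set y | c <= psi y]).
Proof.
rewrite (_ : [set y | _] = psi @^-1` `[c, +oo[); first exact: mpsi.
by apply/seteqP; split => x /=; rewrite in_itv/= andbT.
Qed.

(** A sequence coinitial in the image of A under [psi] suffices to exhaust A. Measurability of sets
    defined by [upper_mass] comes from here. *)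
Let upward_bigcup A : upward A -> A !=set0 -> exists x : nat -> T,
  [/\ forall n, A (x n), forall m n, (m <= n)%N -> psi (x n) <= psi (x m) &
      A = \bigcup_n (B `&` [set y | psi (x n) <= psi y])].
Proof.
move=> [AB uA] [x0 Ax0].
have [|u [Su uni uS]] := @coinitial_sequence R (psi @` A); first by exists (psi x0), x0.
have /choice[x xu] : forall n, exists x, A x /\ psi x = u n.
  by move=> n; have [x Ax <-] := Su n; exists x.
exists x; split.
- by move=> n; case: (xu n).
- by move=> m n mn; rewrite !(xu _).2; exact: uni.
apply/seteqP; split => [y Ay|y [n _ [By /= xy]]].
  have [|n un] := uS (psi y); first by exists y.
  by exists n => //; split; [exact: AB|rewrite /= (xu n).2].
exact: (uA _ _ (xu n).1).
Qed.

Lemma upward_measurable A : upward A -> measurable A.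
Proof.
move=> uA; have [->//|/set0P A0] := eqVneq A set0.
have [x [_ _ ->]] := upward_bigcup uA A0.
by apply: bigcupT_measurable => n; exact: mge.
Qed.

Lemma upper_mass_ni x y : psi x <= psi y ->
  (upper_mass y <= upper_mass x)%E.
Proof.
move=> xy; apply: le_measure; rewrite ?inE; try exact: measurable_gt.
by move=> z [Bz /= yz]; split => //=; exact: le_lt_trans yz.
Qed.

Lemma upward_upper_mass r : upward (B `&` [set x | (upper_mass x < r)%E]).
Proof.
split; first exact: subIsetl.
move=> x y [Bx /= xr] By xy; split => //=; apply: le_lt_trans xr.
exact: upper_mass_ni.
Qed.

Lemma upward_upper_mass0 : upward (B `&` [set x | (upper_mass x <= 0)%E]).
Proof.
split; first exact: subIsetl.
move=> x y [Bx /= xr] By xy; split => //=; apply: le_trans xr.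
exact: upper_mass_ni.
Qed.

Context (psi_level0 : forall c, nu (B `&` [set y | psi y = c]) = 0%E).
Context (upper_mass_fin : forall x, B x -> (upper_mass x < +oo)%E).

(** The set A of points of rank below r is approached from inside by superlevel sets at points of A,
    of mass below r, and from outside by strict superlevel sets at points of B outside A, of mass at
    least r. *)
Lemma measure_upper_mass_lt r : (0 <= r)%E ->
  nu (B `&` [set x | (upper_mass x < r)%E]) = mine r (nu B).
Proof.
move=> r0; set A := B `&` _.
have uA : upward A by exact: upward_upper_mass.
have mA : measurable A by exact: upward_measurable.
apply/eqP; rewrite eq_le; apply/andP; split.
  rewrite le_min; apply/andP; split; last first.
    by apply: le_measure; rewrite ?inE//; exact: subIsetl.
  have [->|/set0P A0] := eqVneq A set0; first by rewrite measure0.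
  have [x [Ax xni AE]] := upward_bigcup uA A0.
  pose F n := B `&` [set y | psi (x n) <= psi y].
  have cF : (nu \o F) n @[n --> \oo] --> nu A.
    rewrite AE; apply: nondecreasing_cvg_mu => //.
    - by move=> n; exact: mge.
    - by apply: bigcupT_measurable => n; exact: mge.
    move=> m n mn; apply/subsetPset => y [By /= my]; split => //=.
    exact: le_trans (xni _ _ mn) my.
  rewrite -(cvg_lim _ cF)//; apply: lime_le; first by apply/cvg_ex; eexists; exact: cF.
  apply: nearW => n /=.
  (* The closed superlevel set exceeds the open one, whose mass is the rank of [x n], by a null
     level set. *)
  have -> : F n = (B `&` [set y | psi (x n) < psi y]) `|`
                  (B `&` [set y | psi y = psi (x n)]).
    apply/seteqP; split => [y [By]|y [[By /= h]|[By /= h]]].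
    - by rewrite /= le_eqVlt => /predU1P[|]; [right|left].
    - by split => //=; exact: ltW.
    - by split => //=; rewrite h.
  apply: (@le_trans _ _ (upper_mass (x n) +
                         nu (B `&` [set y | psi y = psi (x n)]))%E).
    apply: measureU2; first exact: measurable_gt.
    by rewrite (_ : [set y | _] = psi @^-1` [set psi (x n)])//; exact: mpsi.
  by rewrite psi_level0 adde0; apply/ltW; case: (Ax n).
have [BA|/existsNP[x0 /not_implyP[Bx0 Ax0]]] := pselect (B `<=` A).
  by rewrite ge_min; apply/orP; right; apply: le_measure; rewrite ?inE.
(* The sign turns the coinitial sequence into values of [psi] that increase towards the supremum
   over the points outside A. *)
have [|v [Sv vni vS]] := @coinitial_sequence R ((fun x => - psi x) @` (B `\` A)).
  by exists (- psi x0), x0.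
pose F n := B `&` [set y | - v n < psi y].
have rF n : exists2 x, (B `\` A) x & nu (F n) = upper_mass x.
  by have [x BAx vx] := Sv n; exists x => //; rewrite /F -vx opprK.
have mF n : measurable (F n) by exact: measurable_gt.
have cF : (nu \o F) n @[n --> \oo] --> nu (\bigcap_n F n).
  apply: nonincreasing_cvg_mu => //.
  - by have [x [Bx _] ->] := rF 0%N; exact: upper_mass_fin.
  - exact: bigcapT_measurable.
  move=> m n mn; apply/subsetPset => y [By /= my]; split => //=.
  by apply: le_lt_trans my; rewrite lerN2 vni.
rewrite ge_min; apply/orP; left; apply: (@le_trans _ _ (nu (\bigcap_n F n))).
  rewrite -(cvg_lim _ cF)//; apply: lime_ge; first by apply/cvg_ex; eexists; exact: cF.
  apply: nearW => n /=; have [x [Bx Ax] ->] := rF n.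
  by rewrite leNgt; apply/negP => xr; apply: Ax.
apply: le_measure; rewrite ?inE//; first exact: bigcapT_measurable.
move=> y Fy; apply: contrapT => Ay.
have By : B y by case: (Fy 0%N I).
have [|n vy] := vS (- psi y); first by exists y.
by have := (Fy n I).2 => /=; rewrite ltNge lerNr vy.
Qed.

Lemma measure_upper_mass0 :
  nu (B `&` [set x | (upper_mass x <= 0)%E]) = 0%E.
Proof.
apply/eqP; rewrite eq_le measure_ge0 andbT; apply/lee_addgt0Pr => e e0.
rewrite add0e; apply: (@le_trans _ _ (nu (B `&` [set x | (upper_mass x < e%:E)%E]))).
  apply: le_measure; rewrite ?inE.
  - exact/upward_measurable/upward_upper_mass0.
  - exact/upward_measurable/upward_upper_mass.
  by move=> x [Bx /= x0]; split => //=; apply: le_lt_trans x0 _; rewrite lte_fin.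
rewrite measure_upper_mass_lt; first by rewrite ge_min lexx.
by rewrite lee_fin ltW.
Qed.

End uniformization.

(** * Limits and infinite values of the overlap *)

Lemma lim_mine (R : realType) (u : nat -> \bar R) (l c : \bar R) :
  (forall m n, (m <= n)%N -> (u m <= u n)%E) -> (forall n, (u n <= l)%E) ->
  u n @[n --> \oo] --> l ->
  limn (fun n => mine (u n) c) = mine l c.
Proof.
move=> und ul ucvg.
have cv : cvgn (fun n => mine (u n) c).
  apply: ereal_nondecreasing_is_cvgn => m n mn.
  by rewrite le_min !ge_min und//= lexx orbT.
apply/eqP; rewrite eq_le; apply/andP; split.
  apply: lime_le => //; apply: nearW => n.
  by rewrite le_min !ge_min ul//= lexx orbT.
have [[n0 cu]|h] := pselect (exists n, (c <= u n)%E).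
  rewrite ge_min; apply/orP; right; apply: lime_ge => //.
  exists n0 => // n /= n0n; rewrite le_min lexx andbT.
  by apply: (le_trans cu); exact: und.
rewrite ge_min; apply/orP; left.
rewrite (_ : (fun n => mine (u n) c) = u) ?(cvg_lim _ ucvg)//.
apply/funext => n; apply/min_idPl; rewrite leNgt; apply/negP => cu.
by apply: h; exists n; exact: ltW.
Qed.

(** Monotone convergence, once in each variable; this is what allows f to be replaced by its
    truncations. *)
Lemma overlap_le_lim (R : realType) (p : nat -> R -> \bar R) (l q : R -> \bar R)
    (C : \bar R) :
  (forall n s, 0 < s -> (0 <= p n s)%E) ->
  (forall n s s', 0 < s -> s <= s' -> (p n s' <= p n s)%E) ->
  (forall s m n, 0 < s -> (m <= n)%N -> (p m s <= p n s)%E) ->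
  (forall n s, 0 < s -> (p n s <= l s)%E) ->
  (forall s, 0 < s -> p n s @[n --> \oo] --> l s) ->
  (forall s, 0 < s -> (0 <= q s)%E) ->
  (forall s s', 0 < s -> s <= s' -> (q s' <= q s)%E) ->
  (forall n, (overlap (p n) q <= C)%E) -> (overlap l q <= C)%E.
Proof.
move=> p0 pni pnd pl pcvg q0 qni pC.
have n2 n : ni2 (fun s u => mine (p n s) (q u)).
  by apply: ni2_mine => // *; [exact: p0|exact: pni].
have itv s : (s \in (`]0, +oo[%classic : set R)) -> 0 < s.
  by rewrite inE/= in_itv/= andbT.
pose H n s := (\int[lebesgue_measure]_(u in `]0%R, +oo[) mine (p n s) (q u))%E.
have Hlim s : 0 < s -> (\int[lebesgue_measure]_(u in `]0%R, +oo[) mine (l s) (q u) =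
    limn (fun n => H n s))%E.
  move=> s0; rewrite /H -monotone_convergence//.
  - apply: eq_integral => u /itv u0; apply/esym/lim_mine.
    + by move=> m n; exact: pnd.
    + by move=> n; exact: pl.
    + exact: pcvg.
  - move=> n; apply: ni_measurable_itv0y => u u' u0 uu'.
    by case: (n2 n) => _ _; apply.
  - move=> n u; rewrite /= in_itv/= andbT => u0.
    by case: (n2 n) => + _ _; apply.
  - move=> u; rewrite /= in_itv/= andbT => u0 m n mn.
    by rewrite le_min !ge_min pnd//= lexx orbT.
have Hnd s m n : 0 < s -> (m <= n)%N -> (H m s <= H n s)%E.
  move=> s0 mn; apply: le_integral_ni => [u u0|u u' u0 uu'|u u' u0 uu'|u u0].
  - by case: (n2 m) => + _ _; apply.
  - by case: (n2 m) => _ _; apply.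
  - by case: (n2 n) => _ _; apply.
  - by rewrite le_min !ge_min pnd//= lexx orbT.
have -> : overlap l q = limn (fun n => overlap (p n) q).
  rewrite /overlap -monotone_convergence//.
  - by apply: eq_integral => s /itv s0; exact: Hlim.
  - by move=> n; apply: ni_measurable_itv0y => s s' s0 ss'; exact: (ni2_integral (n2 n)).
  - move=> n s; rewrite /= in_itv/= andbT => s0; apply: integral_ge0 => u.
    by rewrite /= in_itv/= andbT => u0; case: (n2 n) => + _ _; apply.
  - move=> s; rewrite /= in_itv/= andbT => s0 m n mn; exact: Hnd.
apply: lime_le; last by apply: nearW => n; exact: pC.
apply: ereal_nondecreasing_is_cvgn => m n mn; apply: le_integral_ni.
- move=> s s0; apply: integral_ge0 => u.
  by rewrite /= in_itv/= andbT => u0; case: (n2 m) => + _ _; apply.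
- by move=> s s' s0 ss'; exact: (ni2_integral (n2 m)).
- by move=> s s' s0 ss'; exact: (ni2_integral (n2 n)).
- by move=> s s0; exact: Hnd.
Qed.

(** The inner integral is the integral of q, the same for every s and at least u r > 0; integrating
    it over an infinite interval gives infinity. *)
Lemma overlap_infinite (R : realType) (p q : R -> \bar R) (u r : R) :
  0 < u -> 0 < r ->
  (forall s, 0 < s -> p s = +oo%E) -> (forall s, 0 < s -> (0 <= q s)%E) ->
  (forall s s', 0 < s -> s <= s' -> (q s' <= q s)%E) -> (r%:E <= q u)%E ->
  overlap p q = +oo%E.
Proof.
move=> u0 r0 poo q0 qni rq.
pose c := (\int[lebesgue_measure]_(s in `]0%R, +oo[) q s)%E.
have -> : overlap p q = (\int[lebesgue_measure]_(s in `]0%R, +oo[) cst c s)%E.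
  apply: eq_integral => s; rewrite inE/= in_itv/= andbT => s0.
  by apply: eq_integral => t _; rewrite poo// minye.
rewrite integral_cst// [X in (_ * X)%E]lebesgue_measure_itv/= ltry gt0_muley//.
have mq := ni_measurable_itv0y qni.
have sub : `]0, u[%classic `<=` (`]0, +oo[%classic : set R).
  by move=> x; rewrite /= !in_itv/= andbT => /andP[].
have cst_gt0 : (0 < \int[lebesgue_measure]_(s in `]0%R, u[) cst r%:E s)%E.
  rewrite integral_cst// [X in (_ * X)%E]lebesgue_measure_itv/= lte_fin u0 sube0.
  by rewrite -EFinM lte_fin mulr_gt0.
apply: (lt_le_trans cst_gt0).
have le1 : (\int[lebesgue_measure]_(s in `]0%R, u[) cst r%:E s <=
            \int[lebesgue_measure]_(s in `]0%R, u[) q s)%E.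
  apply: ge0_le_integral => //.
  - by move=> x _; rewrite lee_fin ltW.
  - by apply: (measurable_funS _ sub).
  move=> x; rewrite /= in_itv/= => /andP[x0 xu].
  by apply: (le_trans rq); apply: qni => //; exact: ltW.
apply: (le_trans le1); apply: ge0_subset_integral => //.
by move=> x; rewrite /= in_itv/= andbT => x0; exact: q0.
Qed.

(** * Resonance *)

Lemma leb_setD_null (R : realType) (A Z : set (lebR R)) :
  measurable A -> measurable Z -> leb Z = 0%E -> leb (A `\` Z) = leb A.
Proof.
move=> mA mZ Z0; apply/eqP; rewrite eq_le; apply/andP; split.
  by apply: le_measure; rewrite ?inE//; exact: measurableD.
rewrite -[leRHS]adde0 -Z0; apply: (@le_trans _ _ (leb ((A `\` Z) `|` Z))).
  apply: le_measure; rewrite ?inE//; first by apply: measurableU => //; exact: measurableD.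
  by move=> x Ax; have [Zx|Zx] := pselect (Z x); [right|left].
by apply: measureU2 => //; exact: measurableD.
Qed.

(* The values of [N] are integers and [0 < (1 + x)^-1 < 1], so [N x + (1 + x)^-1]
   orders the points of [B] first by [N], then by decreasing position, and has
   no level set of positive measure. *)
Lemma tie_breaking_level0 (R : realType) (B : set (lebR R)) (N : R -> nat) (c : R) :
  B `<=` [set x : R | 0 < x] ->
  leb (B `&` [set x : R | (N x)%:R + (1 + x)^-1 = c]) = 0%E.
Proof.
move=> B0; set Z := B `&` _.
have [->|/set0P[x [Bx xc]]] := eqVneq Z set0; first exact: measure0.
suff -> : Z = [set x : R] by rewrite lebE lebesgue_measure_set1.
have eta01 (y : R) : 0 < y -> 0 < (1 + y)^-1 < 1.
  move=> y0; have y1 : 0 < 1 + y by lra.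
  by rewrite invr_gt0 y1/= invf_lt1//; lra.
apply/seteqP; split => [y [By yc]|_ ->]//.
have x0 : 0 < x := B0 _ Bx; have y0 : 0 < y := B0 _ By.
have /andP[hx hx1] := eta01 _ x0; have /andP[hy hy1] := eta01 _ y0.
move: xc yc => /= xc yc.
have Nxy : N x = N y.
  apply/eqP; rewrite eqn_leq; apply/andP; split; rewrite leqNgt; apply/negP.
    by rewrite -(ler_nat R) -natr1 => h; lra.
  by rewrite -(ler_nat R) -natr1 => h; lra.
have /invr_inj : (1 + y)^-1 = (1 + x)^-1 by move: xc; rewrite Nxy; lra.
by move/addrI.
Qed.

Lemma tie_breaking_le (R : realType) (N : R -> nat) (x y : R) : 0 < x -> 0 < y ->
  (N x)%:R + (1 + x)^-1 <= (N y)%:R + (1 + y)^-1 -> (N x <= N y)%N.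
Proof.
move=> x0 y0 h; rewrite leqNgt; apply/negP; rewrite -(ler_nat R) -natr1.
have x1 : 0 < (1 + x)^-1 by rewrite invr_gt0; lra.
have y1 : (1 + y)^-1 < 1 by rewrite invf_lt1; lra.
by move=> h'; lra.
Qed.

(** [psi] refines the order in which N lists the values of |F|, so superlevel sets of F and of k^#
    composed with the rank are nested up to a null set. Finite mass of B makes the ranks finite, and
    finiteness of d_k at [u0] makes k^# finite at positive ranks. *)
Lemma resonance_step (R : realType) (I B : set (lebR R)) (N : R -> nat)
    (F k : lebR R -> R) (u0 : R) :
  measurable I -> measurable B -> B `<=` I -> B `<=` [set x : R | 0 < x] ->
  (leb B < +oo)%E -> L0 B (fun x => (N x)%:R) ->
  L0 I F -> (forall x, I x -> ~ B x -> F x = 0) ->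
  (forall x y, B x -> B y -> (N x <= N y)%N -> `|F x| <= `|F y|) ->
  L0 I k -> (distribution leb I k u0 < +oo)%E ->
  exists g, [/\ L0 I g,
    forall u, 0 < u -> (distribution leb I g u <= distribution leb I k u)%E &
    (overlap (distribution leb I F) (distribution leb I k) <=
     \int[leb]_(x in I) `|F x * g x|%:E)%E].
Proof.
move=> mI mB BI B0 lB mN mF F0 FN mk ku0.
pose psi (x : lebR R) : R := (N x)%:R + (1 + x)^-1.
have mpsi : L0 B psi.
  apply: (@L0_add R B (fun x => (N x)%:R) (fun x : R => (1 + x)^-1)) => //.
  apply: (measurable_funS _ B0).
    apply: is_interval_lebR_measurable => x y /= x0 _ z /andP[xz _].
    exact: lt_le_trans xz.
  apply: nonincreasing_lebR_measurable.
    by move=> x y /= x0 _ z /andP[xz _]; exact: lt_le_trans xz.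
  by move=> x y /= x0 y0 xy; rewrite lef_pV2 ?posrE; lra.
have psi0 c : leb (B `&` [set y | psi y = c]) = 0%E by exact: tie_breaking_level0.
pose sigma := upper_mass leb B psi.
have sigma_fin x : (sigma x < +oo)%E.
  apply: le_lt_trans lB; apply: le_measure; rewrite ?inE//; exact: measurable_gt.
have sigma_finB x : B x -> (sigma x < +oo)%E by [].
pose Z := B `&` [set x | (sigma x <= 0)%E].
pose T u := B `&` [set x | (sigma x < distribution leb I k u)%E].
have uZ : upward B psi Z by exact: upward_upper_mass0.
have uT u : upward B psi (T u) by exact: upward_upper_mass.
have mZ : measurable Z by exact: upward_measurable uZ.
have mT u : measurable (T u) by exact: upward_measurable (uT u).
have Z0 : leb Z = 0%E by exact: measure_upper_mass0.
have Tmass u : leb (T u) = mine (distribution leb I k u) (leb B).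
  by apply: measure_upper_mass_lt => //; exact: measure_ge0.
(* [k^*] composed with the rank; the null set [Z] is where [k^*] is evaluated
   at [0] and may be infinite. *)
pose g x := if x \in B `\` Z then fine (rearr leb I k (fine (sigma x))) else 0.
have gE u : 0 <= u -> I `&` [set x | u < `|g x|] = T u `\` Z.
  move=> u_ge0.
  have key x : B x -> ~ Z x ->
      (u < `|fine (rearr leb I k (fine (sigma x)))|) =
      (sigma x < distribution leb I k u)%E.
    move=> Bx Zx.
    have sx0 : (0 < sigma x)%E by rewrite ltNge; apply/negP => h; apply: Zx.
    have sfin : sigma x \is a fin_num by rewrite ge0_fin_numE ?ltW.
    have s0 : 0 < fine (sigma x) by rewrite fine_gt0// sx0 sigma_fin.
    rewrite ger0_norm; last exact/fine_ge0/rearr_ge0.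
    rewrite -lte_fin fineK; last exact: rearr_fin_num ku0 _.
    by rewrite rearr_gt// fineK.
  apply/seteqP; split => x.
    move=> [Ix]; rewrite /= /g; case: ifPn; last by rewrite normr0 ltNge u_ge0.
    by rewrite inE => -[Bx Zx]; rewrite key// => h; split => //; split.
  move=> [[Bx sx] Zx]; split; first exact: BI.
  by rewrite /= /g ifT ?inE// key.
have mg : L0 I g.
  apply: measurable_fun_gt => // s; have [s0|s0] := leP 0 s.
    rewrite (_ : _ `&` _ = T s `\` Z); first exact: measurableD.
    rewrite -gE//; apply/seteqP; split => x [Ix /= gx]; split => //=.
      by apply: lt_le_trans gx _; exact: ler_norm.
    rewrite -(ger0_norm (_ : 0 <= g x))// /g; case: ifP => // _.
    exact/fine_ge0/rearr_ge0.
  rewrite (_ : _ `&` _ = I)//; apply: setIidl => x _ /=; apply: lt_le_trans s0 _.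
  by rewrite /g; case: ifP => // _; exact/fine_ge0/rearr_ge0.
exists g; split => //.
  move=> u u_gt0; rewrite [leLHS]/distribution (gE _ (ltW u_gt0)).
  have -> := leb_setD_null (mT u) mZ Z0.
  by rewrite Tmass ge_min lexx.
rewrite le_eqVlt; apply/orP; left; apply/eqP.
apply: etrans _ (esym (leb_double_layer_cake mI mF mg)).
apply: eq_integral => s; rewrite inE/= in_itv/= andbT => s_gt0.
apply: eq_integral => u; rewrite inE/= in_itv/= andbT => u_gt0.
(* Since A lies in B, capping d_k at the mass of B does not change its minimum with the mass of
   A. *)
pose A := I `&` [set x | s < `|F x|].
have AB : A `<=` B.
  move=> x [Ix /= sx]; apply: contrapT => Bx; move: sx.
  by rewrite F0// normr0 ltNge ltW.
have uA : upward B psi A.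
  split=> // x y [Ix /= sx] By xy; split; first exact: BI.
  apply: (lt_le_trans sx); apply: FN => //; first exact: AB.
  by apply: tie_breaking_le xy; apply: B0 => //; exact: AB.
have mA : measurable A by exact: measurable_abs_gt.
have -> : A `&` [set x | u < `|g x|] = (A `&` T u) `\` Z.
  rewrite -setIDA -(gE _ (ltW u_gt0)) setIA; congr (_ `&` _).
  by apply/esym/setIidl => x [].
have -> := leb_setD_null (measurableI _ _ mA (mT u)) mZ Z0.
rewrite -/A [distribution leb I F s]/distribution -/A.
have leAB : (leb A <= leb B)%E by apply: le_measure; rewrite ?inE.
have := Tmass u; case: (upward_nested uA (uT u)) => [AT|TA] TE.
  rewrite (setIidl AT); apply/min_idPl.
  have : (leb A <= leb (T u))%E by apply: le_measure; rewrite ?inE.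
  by rewrite TE le_min => /andP[].
rewrite (setIidr TA) TE.
have : (leb (T u) <= leb A)%E by apply: le_measure; rewrite ?inE.
rewrite TE => h; apply/eqP.
by rewrite eq_le !le_min h !ge_min lexx leAB/= ?orbT ?andbT.
Qed.

(** * Dyadic approximation from below *)

Section dyadic_truncation.
Context (R : realType) (I : set (lebR R)) (f : lebR R -> R).

(** The integer is kept apart from the value because tie breaking orders points by it. It may take
    infinitely many values: only integrality matters. *)
Definition dyadic_level (n : nat) (x : R) : nat := Num.truncn (2 ^+ n * `|f x|).

Definition dyadic_window (n : nat) : set (lebR R) := I `&` itv0 n%:R%:E.

Definition dyadic (n : nat) : lebR R -> R :=
  (fun x => (dyadic_level n x)%:R / 2 ^+ n : R) \_ (dyadic_window n).

Context (mI : measurable I) (I0 : I `<=` [set x : R | 0 < x]) (mf : L0 I f).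

Lemma dyadic_window_measurable n : measurable (dyadic_window n).
Proof. by apply: measurableI => //; exact: measurable_itv0. Qed.

Lemma dyadic_window_lty n : (leb (dyadic_window n) < +oo)%E.
Proof.
apply: (@le_lt_trans _ _ (leb (itv0 (n%:R%:E : \bar R)))); last first.
  by rewrite leb_itv0 ?ltry// lee_fin.
apply: le_measure; rewrite ?inE//.
- exact: dyadic_window_measurable.
- exact: measurable_itv0.
- exact: subIsetr.
Qed.

Lemma dyadic_level_measurable n :
  L0 (dyadic_window n) (fun x => (dyadic_level n x)%:R).
Proof.
have mt : measurable_fun setT (fun y : R => (Num.truncn y)%:R : R).
  apply: nondecreasing_measurable => // x y xy; rewrite ler_nat; exact: le_truncn.
have m2 : L0 (dyadic_window n) (fun x => 2 ^+ n * `|f x|).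
  apply: (@L0_mul R _ (fun=> 2 ^+ n) (fun x => `|f x|)); first exact: measurable_cst.
  apply: L0_norm; apply: (measurable_funS mI _ mf); exact: subIsetl.
exact: measurableT_comp mt m2.
Qed.

Lemma dyadic_ge0 n x : 0 <= dyadic n x.
Proof. by rewrite /dyadic patchE; case: ifP => // _; rewrite divr_ge0. Qed.

Lemma dyadic_out n x : ~ dyadic_window n x -> dyadic n x = 0.
Proof. by move=> h; rewrite /dyadic patchE memNset. Qed.

Lemma dyadic_measurable n : L0 I (dyadic n).
Proof.
apply: measurable_funTS; apply/(measurable_restrictT _ (dyadic_window_measurable n)).
apply: (@L0_mul R _ (fun x => (dyadic_level n x)%:R) (fun=> (2 ^+ n)^-1)).
  exact: dyadic_level_measurable.
exact: measurable_cst.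
Qed.

Lemma dyadic_mono n x y : dyadic_window n x -> dyadic_window n y ->
  (dyadic_level n x <= dyadic_level n y)%N -> `|dyadic n x| <= `|dyadic n y|.
Proof.
move=> Bx By xy; rewrite !ger0_norm ?dyadic_ge0// /dyadic !patchE !mem_set//.
by rewrite ler_wpM2r// ?invr_ge0// ler_nat.
Qed.

Lemma dyadic_le n x : dyadic n x <= `|f x|.
Proof.
rewrite /dyadic patchE; case: ifP => _; last exact: normr_ge0.
by rewrite ler_pdivrMr ?exprn_gt0// mulrC truncn_le mulr_ge0// exprn_ge0.
Qed.

Lemma dyadic_nd m n x : (m <= n)%N -> dyadic m x <= dyadic n x.
Proof.
move=> mn; have [xm|xm] := pselect (dyadic_window m x); last first.
  by rewrite dyadic_out// dyadic_ge0.
have xn : dyadic_window n x.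
  case: xm => Ix [x0 xm]; split => //; split => //; apply: lt_le_trans xm _.
  by rewrite lee_fin ler_nat.
have E2 : 2 ^+ n = 2 ^+ (n - m) * 2 ^+ m :> R by rewrite -exprD subnK.
(* The left side is an integer not exceeding 2^n |f x|, hence not exceeding its integer part. *)
have key : (dyadic_level m x * 2 ^ (n - m) <= dyadic_level n x)%N.
  rewrite truncn_ge_nat; last by rewrite mulr_ge0// exprn_ge0.
  rewrite natrM natrX E2 -mulrA mulrC ler_wpM2l ?exprn_ge0//.
  by rewrite truncn_le mulr_ge0// exprn_ge0.
rewrite /dyadic !patchE !mem_set//.
rewrite ler_pdivrMr ?exprn_gt0// mulrAC ler_pdivlMr ?exprn_gt0// E2 mulrA.
by rewrite ler_wpM2r ?exprn_ge0// -natrX -natrM ler_nat.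
Qed.

Lemma dyadic_gt (s : R) x : I x -> s < `|f x| -> exists n, s < dyadic n x.
Proof.
move=> Ix sx; have [k hk] := ltr_add_invr sx.
have x0 : 0 < x by exact: I0.
(* The first entry makes the rounding error 2^-n at most 1/(k+1); the second puts x into the
   window. *)
pose n := maxn k.+1 (Num.truncn x).+1.
exists n; rewrite /dyadic patchE mem_set; last first.
  split => //; split => //; rewrite lte_fin; apply: lt_le_trans (truncnS_gt _) _.
  by rewrite ler_nat leq_maxr.
have hn : k.+1%:R <= 2 ^+ n :> R.
  rewrite -natrX ler_nat; apply: leq_trans (leq_maxl k.+1 (Num.truncn x).+1) _.
  by rewrite ltnW// ltn_expl.
have n0 : 0 < 2 ^+ n :> R by rewrite exprn_gt0.
rewrite ltr_pdivlMr//.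
have h : `|f x| * 2 ^+ n < (dyadic_level n x)%:R + 1.
  by rewrite natr1 mulrC; exact: truncnS_gt.
have h1 : 1 <= k.+1%:R^-1 * 2 ^+ n :> R by rewrite mulrC ler_pdivlMr ?mul1r.
have h2 : (s + k.+1%:R^-1) * 2 ^+ n < `|f x| * 2 ^+ n by rewrite ltr_pM2r.
move: h2; rewrite mulrDl => h2.
rewrite -(ltrD2r 1); apply: le_lt_trans h; apply: le_trans (ltW h2).
by rewrite lerD2l.
Qed.

End dyadic_truncation.

(** Each truncation F n has its own aligned g, and F n <= |f| bounds the resulting integral by C.
    The distribution functions of F n increase to that of f, so the bound passes to the limit. *)
Lemma resonance (R : realType) (I : set (lebR R)) (f k : lebR R -> R) (u0 : R)
    (C : \bar R) :
  measurable I -> I `<=` [set x : R | 0 < x] -> L0 I f -> L0 I k ->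
  (distribution leb I k u0 < +oo)%E ->
  (forall g, L0 I g ->
    (forall u, 0 < u -> (distribution leb I g u <= distribution leb I k u)%E) ->
    (\int[leb]_(x in I) `|f x * g x|%:E <= C)%E) ->
  (overlap (distribution leb I f) (distribution leb I k) <= C)%E.
Proof.
move=> mI I0 mf mk ku0 fgC.
pose F := dyadic I f.
have mF n : L0 I (F n) by exact: dyadic_measurable.
have FE n s : I `&` [set x | s < `|F n x|] = I `&` [set x | s < F n x].
  by apply/seteqP; split => x [Ix /= h]; split => //=; move: h; rewrite ger0_norm// dyadic_ge0.
have mFs n s : measurable (I `&` [set x | s < F n x]).
  by rewrite -FE; exact: (measurable_abs_gt s mI (mF n)).
apply: (@overlap_le_lim _ (fun n => distribution leb I (F n))) => //.
- by move=> n s s' _; exact: distribution_ni.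
- move=> s m n _ mn; rewrite /distribution !FE; apply: le_measure; rewrite ?inE//.
  by move=> x [Ix /= sx]; split => //=; apply: lt_le_trans sx _; exact: dyadic_nd.
- move=> n s _; rewrite /distribution FE; apply: le_measure; rewrite ?inE//.
    exact: measurable_abs_gt.
  by move=> x [Ix /= sx]; split => //=; apply: lt_le_trans sx _; exact: dyadic_le.
- move=> s s0; rewrite [X in _ --> X]/distribution.
  rewrite (_ : I `&` _ = \bigcup_n (I `&` [set x | s < F n x])); last first.
    apply/seteqP; split => x.
      by move=> [Ix /= /(dyadic_gt I0 Ix)[n sn]]; exists n.
    by move=> [n _ [Ix /= sx]]; split => //=; apply: lt_le_trans sx _; exact: dyadic_le.
  rewrite (_ : (fun n => _) = leb \o (fun n => I `&` [set x | s < F n x])); last first.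
    by apply/funext => n; rewrite /= /distribution FE.
  apply: nondecreasing_cvg_mu => //; first exact: bigcupT_measurable.
  move=> m n mn; apply/subsetPset => x [Ix /= sx]; split => //=.
  by apply: lt_le_trans sx _; exact: dyadic_nd.
- by move=> s s' _; exact: distribution_ni.
move=> n.
have [g [mg gk ovl]] : exists g, [/\ L0 I g,
    forall u, 0 < u -> (distribution leb I g u <= distribution leb I k u)%E &
    (overlap (distribution leb I (F n)) (distribution leb I k) <=
     \int[leb]_(x in I) `|F n x * g x|%:E)%E].
  apply: (@resonance_step R I (dyadic_window I n) (dyadic_level f n) (F n) k u0) => //.
  - exact: dyadic_window_measurable.
  - exact: subIsetl.
  - by move=> x [_ []].
  - exact: dyadic_window_lty.
  - exact: dyadic_level_measurable.
  - by move=> x _; exact: dyadic_out.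
  - exact: dyadic_mono.
apply: le_trans ovl _; apply: le_trans (fgC _ mg gk).
apply: le_leb_integral => //.
- by apply: L0_norm; exact: L0_mul.
- by apply: L0_norm; exact: L0_mul.
move=> x _; rewrite !normrM ler_wpM2r// ger0_norm ?dyadic_ge0//.
exact: dyadic_le.
Qed.

(** * The weighted measure and the spaces *)

Lemma fine_rearr_nonincreasing (R : realType) (mu : set (lebR R) -> \bar R)
    (O : set (lebR R)) (f : lebR R -> R) :
  (forall t : R, 0 < t -> rearr mu O f t \is a fin_num) ->
  forall x y : R, 0 < x -> 0 < y -> x <= y ->
  fine (rearr mu O f y) <= fine (rearr mu O f x).
Proof. by move=> finf x y x0 y0 xy; rewrite fine_le ?finf//; exact: rearr_ni. Qed.

Lemma fine_rearr_ge0 (R : realType) (mu : set (lebR R) -> \bar R)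
    (O : set (lebR R)) (f : lebR R -> R) t : 0 <= fine (rearr mu O f t).
Proof. exact/fine_ge0/rearr_ge0. Qed.

Section weight.
Context (R : realType) (a b : \bar R) (w : lebR R -> R).
Context (a_gt0 : (0 < a)%E)
  (w_gt0 : forall t, itv0 a t -> 0 < w t)
  (w_decr : forall s t : R, itv0 a s -> itv0 a t -> s <= t -> w t <= w s)
  (W_fin : forall t : R, itv0 a t ->
    (\int[leb]_(s in `]0%R, t[) (w s)%:E < +oo)%E)
  (b_def : b = (\int[leb]_(t in itv0 a) (w t)%:E)%E).

Lemma weight_L0 : L0 (itv0 a) w.
Proof.
apply: nonincreasing_lebR_measurable; first exact: is_interval_itv0.
exact: w_decr.
Qed.

(** Nothing is known about w outside I, where it may be negative or not measurable; extending it by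
    0 gives a genuine measure that agrees with [wmeas w] inside I. *)
Lemma wmeas_measure : exists nu : {measure set (lebR R) -> \bar R},
  forall A : set (lebR R), A `<=` itv0 a -> nu A = wmeas w A.
Proof.
pose v : lebR R -> \bar R := (EFin \o w) \_ (itv0 a).
have v0 x : (0 <= v x)%E by apply: erestrict_ge0 => t /w_gt0 /ltW; rewrite lee_fin.
have mv : measurable_fun setT v.
  apply/(measurable_restrictT _ (measurable_itv0 a)).
  by apply/measurable_EFinP; exact: weight_L0.
exists (density leb v0 mv) => A Aa; apply: eq_integral => x; rewrite inE => Ax.
by rewrite /v patchE mem_set//; exact: Aa.
Qed.

Context (nu : {measure set (lebR R) -> \bar R})
  (nuE : forall A : set (lebR R), A `<=` itv0 a -> nu A = wmeas w A).

Lemma nu_itv0 : nu (itv0 a) = b.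
Proof. by rewrite nuE. Qed.

Lemma rearr_wmeas (f : lebR R -> R) :
  rearr (wmeas w) (itv0 a) f = rearr nu (itv0 a) f.
Proof. by apply: eq_rearr => s _; rewrite /distribution nuE//; exact: subIsetl. Qed.

(** This is W(x) for x in I, written as a rank for psi = -x so that the uniformization lemma shows
    that W carries w dm to Lebesgue measure. *)
Definition primitive (x : lebR R) : \bar R :=
  upper_mass nu (itv0 a) (fun x : R => - x) x.

Lemma primitiveE (x : R) : primitive x = nu (itv0 a `&` [set y : R | y < x]).
Proof.
rewrite /primitive /upper_mass; congr (nu (_ `&` _)).
by apply/seteqP; split => y /=; rewrite ltrN2.
Qed.

Lemma itv0_lt (x : R) : itv0 a x ->
  itv0 a `&` [set y : R | y < x] = `]0, x[%classic.
Proof.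
move=> [x0 xa]; apply/seteqP; split => y /=; rewrite in_itv/=.
  by move=> [[-> _] ->].
by move=> /andP[y0 yx]; split => //; split => //; apply: lt_trans xa; rewrite lte_fin.
Qed.

Lemma primitive_fin (x : R) : itv0 a x -> (primitive x < +oo)%E.
Proof.
move=> ax; rewrite primitiveE nuE; last exact: subIsetl.
by rewrite itv0_lt//; exact: W_fin.
Qed.

(** As w decreases, W(x) >= x w(x). *)
Lemma primitive_gt0 (x : R) : itv0 a x -> (0 < primitive x)%E.
Proof.
move=> ax; rewrite primitiveE nuE; last exact: subIsetl.
rewrite itv0_lt// -itv0_EFin /wmeas; have [x0 _] := ax.
have sub : itv0 x%:E `<=` itv0 a by rewrite itv0_EFin -itv0_lt//; exact: subIsetl.
have mx : measurable (itv0 x%:E) by exact: measurable_itv0.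
apply: (@lt_le_trans _ _ (\int[leb]_(y in itv0 x%:E) (cst (w x) y)%:E)%E).
  have xE : leb (itv0 x%:E) = x%:E by rewrite leb_itv0// lee_fin ltW.
  have -> : (\int[leb]_(y in itv0 x%:E) (cst (w x) y)%:E = (w x)%:E * x%:E)%E.
    by rewrite -[in RHS]xE; exact: (@integral_cst _ (lebR R) R leb _ mx (w x)%:E).
  by rewrite -EFinM lte_fin mulr_gt0// w_gt0.
apply: le_leb_integral => //.
- exact: measurable_cst.
- by apply: (measurable_funS (measurable_itv0 a) sub); exact: weight_L0.
- by move=> y _; rewrite /= ltW// w_gt0.
move=> y yx; apply: w_decr => //; first exact: sub.
by case: yx => _; rewrite lte_fin => /ltW.
Qed.

Lemma mass_primitive_lt (r : \bar R) : (0 <= r)%E ->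
  nu (itv0 a `&` [set x | (primitive x < r)%E]) = mine r b.
Proof.
move=> r0; rewrite -nu_itv0.
apply: (@measure_upper_mass_lt _ (lebR R) R nu (itv0 a) (fun x : R => - x)).
- exact: measurable_itv0.
- apply: measurable_funTS; apply: borel_lebR_measurable_fun.
  exact: oppr_measurable.
- move=> c; rewrite nuE; last exact: subIsetl.
  have s1 : itv0 a `&` [set y : R | - y = c] `<=` [set - c].
    by move=> y [_ <-]; rewrite opprK.
  have m1 : measurable (itv0 a `&` [set y : R | - y = c]).
    apply: is_interval_lebR_measurable => x y [ax xc] [ay yc] z.
    have -> : x = y by apply: oppr_inj; rewrite xc yc.
    by rewrite -eq_le => /eqP <-; split.
  apply: (@null_set_integral _ (lebR R) R leb).
  - exact: m1.
  - apply/measurable_EFinP; apply: (measurable_funS (measurable_itv0 a) _ weight_L0).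
    exact: subIsetl.
  apply/eqP; rewrite eq_le measure_ge0 andbT.
  rewrite -(lebesgue_measure_set1 (- c)) -lebE; apply: le_measure; rewrite ?inE//.
  exact: borel_lebR_measurable.
- by move=> x; exact: primitive_fin.
- exact: r0.
Qed.

Lemma b_gt0 : (0 < b)%E.
Proof.
have [x ax] := itv0_nonempty a_gt0.
apply: (@lt_le_trans _ _ (primitive x)); first exact: primitive_gt0.
rewrite -nu_itv0 primitiveE; apply: le_measure; rewrite ?inE//.
  rewrite itv0_lt//; apply: is_interval_lebR_measurable; exact: interval_is_interval.
exact: measurable_itv0.
Qed.

End weight.

(** * Consequences of full symmetry *)

Section fully_symmetric_space.
Context (R : realType) (b : \bar R) (E : fclass (itv0 b)).
Context (E_banach : banach_function_space E) (E_symm : fully_symmetric E).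

Let mJ : measurable (itv0 b). Proof. exact: measurable_itv0. Qed.

Lemma distribution_scale (h : lebR R -> R) (c s : R) : 0 < c ->
  distribution leb (itv0 b) (fun x => c * h x) s =
  distribution leb (itv0 b) h (s / c).
Proof.
move=> c0; rewrite /distribution; congr (leb (_ `&` _)).
by apply/seteqP; split => x /=; rewrite normrM (gtr0_norm c0) ltr_pdivrMr// mulrC.
Qed.

(* If the distribution function of [h] were infinite then [2 h] would be
   submajorized by [h], so [h] would have norm [0]. *)
Lemma carrier_distribution_lty (h : lebR R -> R) : carrier E h ->
  exists2 s : R, 0 < s & (distribution leb (itv0 b) h s < +oo)%E.
Proof.
move=> Eh; apply: contrapT => noS.
have hoo s : 0 < s -> distribution leb (itv0 b) h s = +oo%E.
  move=> s0; apply/eqP; rewrite -leye_eq leNgt; apply/negP => ds.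
  by apply: noS; exists s.
have E2h : carrier E (fun x => 2 * h x) by exact: (bfs_scale E_banach).
have maj : submajorized (itv0 b) (fun x => 2 * h x) h.
  move=> x _; rewrite (_ : rearr _ _ _ = rearr leb (itv0 b) h)//.
  by apply: eq_rearr => s s0; rewrite distribution_scale// !hoo// divr_gt0.
have [_] := fs_submajorized E_symm (bfs_L0 E_banach E2h) Eh maj.
rewrite (bfs_normZ E_banach)// gtr0_norm//.
have /andP[g0 goo] := bfs_norm_fin E_banach Eh.
have : gauge E h \is a fin_num by rewrite ge0_fin_numE.
move: g0; case gE : (gauge E h) => [r| |]//.
rewrite lee_fin => r0 _; rewrite -EFinM lee_fin => r2.
have {}gE : gauge E h = 0%E by rewrite gE; congr EFin; lra.
have [N [mN N0 hN]] := bfs_norm_eq0 E_banach Eh gE.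
have := hoo 1 ltr01; apply/eqP; rewrite lt_eqF//.
apply: (@le_lt_trans _ _ (leb N)); last by rewrite [leb N]N0 ltry.
apply: le_measure; rewrite ?inE//.
  by apply: measurable_abs_gt => //; exact: bfs_L0 Eh.
move=> x [bx /= hx]; apply: hN => /= /(_ bx) hx0.
by move: hx; rewrite hx0 normr0 ltNge ler01.
Qed.

Lemma carrier_rearr_fin_num (h : lebR R -> R) (t : R) : carrier E h -> 0 < t ->
  rearr leb (itv0 b) h t \is a fin_num.
Proof.
move=> Eh; have [s _ ds] := carrier_distribution_lty Eh.
by apply: rearr_fin_num ds => //; exact: bfs_L0 Eh.
Qed.

(** h^# and h have the same rearrangement, so each is submajorized by the other. Submajorization
    yields membership as well, which equimeasurability presupposes. *)
Lemma carrier_fine_rearr (h : lebR R -> R) : (0 < b)%E -> carrier E h ->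
  carrier E (fine \o rearr leb (itv0 b) h) /\
  (gauge E (fine \o rearr leb (itv0 b) h) <= gauge E h)%E.
Proof.
move=> b0 Eh.
have hfin t : 0 < t -> rearr leb (itv0 b) h t \is a fin_num.
  by move=> t0; exact: carrier_rearr_fin_num.
have maj : submajorized (itv0 b) (fine \o rearr leb (itv0 b) h) h.
  move=> x _; rewrite (_ : rearr _ _ (_ \o _) = rearr leb (itv0 b) h)//.
  apply: eq_rearr => s s0.
  exact: (distribution_fine_rearr mJ (bfs_L0 E_banach Eh) (leb_itv0 (ltW b0))
            hfin (ltW s0)).
exact: (fs_submajorized E_symm (L0_fine_rearr hfin) Eh maj).
Qed.

Lemma carrier_le (f g : lebR R -> R) : L0 (itv0 b) f -> carrier E g ->
  (forall x, itv0 b x -> `|f x| <= `|g x|) ->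
  carrier E f /\ (gauge E f <= gauge E g)%E.
Proof.
move=> mf Eg fg.
have aefg : {ae leb, forall x, itv0 b x -> `|f x| <= `|g x|} by exact: aeW.
have Ef := bfs_solid E_banach mf Eg aefg.
by split => //; exact: (bfs_norm_mono E_banach).
Qed.

End fully_symmetric_space.

(** * A weighted Hoelder inequality and the extremal functions *)

Section duality.
Context (R : realType) (a b : \bar R) (w : lebR R -> R) (E : fclass (itv0 b)).
Context (a_gt0 : (0 < a)%E)
  (w_gt0 : forall t, itv0 a t -> 0 < w t)
  (w_decr : forall s t : R, itv0 a s -> itv0 a t -> s <= t -> w t <= w s)
  (W_fin : forall t : R, itv0 a t ->
    (\int[leb]_(s in `]0%R, t[) (w s)%:E < +oo)%E)
  (b_def : b = (\int[leb]_(t in itv0 a) (w t)%:E)%E).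
Context (nu : {measure set (lebR R) -> \bar R})
  (nuE : forall A : set (lebR R), A `<=` itv0 a -> nu A = wmeas w A).

Let I : set (lebR R) := itv0 a.
Let J : set (lebR R) := itv0 b.
Let mI : measurable I. Proof. exact: measurable_itv0. Qed.
Let mJ : measurable J. Proof. exact: measurable_itv0. Qed.
Let lebI : leb I = a. Proof. by apply: leb_itv0; exact: ltW. Qed.
Let b0 : (0 < b)%E. Proof. exact: (b_gt0 a_gt0 w_gt0 w_decr b_def nuE). Qed.
Let lebJ : leb J = b. Proof. by apply: leb_itv0; exact: ltW. Qed.
Let nuI : nu I = b. Proof. exact: (nu_itv0 b_def nuE). Qed.
Let mw : L0 I w. Proof. exact: (weight_L0 w_decr). Qed.
Let w_ge0 x : I x -> 0 <= w x. Proof. by move=> /w_gt0/ltW. Qed.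
Let I_gt0 (x : R) : I x -> 0 < x. Proof. by case. Qed.

Definition leb_star (f : lebR R -> R) : lebR R -> R := fine \o rearr leb I f.
Definition wt_star (f : lebR R -> R) : lebR R -> R := fine \o rearr nu I f.

Let dist_wmeas (f : lebR R -> R) s :
  distribution (wmeas w) I f s = distribution nu I f s.
Proof. by rewrite /distribution nuE//; exact: subIsetl. Qed.

Section star.
Context (f : lebR R -> R) (mf : L0 I f).

Lemma leb_star_L0 (c : \bar R) :
  (forall t : R, 0 < t -> rearr leb I f t \is a fin_num) ->
  L0 (itv0 c) (leb_star f).
Proof. exact: L0_fine_rearr. Qed.

Lemma leb_star_dist s :
  (forall t : R, 0 < t -> rearr leb I f t \is a fin_num) -> 0 < s ->
  distribution leb I (leb_star f) s = distribution leb I f s.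
Proof.
move=> ffin s0.
by apply: (@distribution_fine_rearr R leb I f a s mI mf lebI ffin); exact: ltW.
Qed.

Lemma wt_star_dist s :
  (forall t : R, 0 < t -> rearr nu I f t \is a fin_num) -> 0 < s ->
  distribution leb J (wt_star f) s = distribution (wmeas w) I f s.
Proof.
move=> ffin s0; rewrite dist_wmeas.
by apply: (@distribution_fine_rearr R nu I f b s mI mf nuI ffin); exact: ltW.
Qed.

End star.

(** After each use of Hardy-Littlewood the distribution functions are realized by decreasing
    functions, for which the overlap is again an integral: f^# and g^# on I, then their weighted
    counterparts on J. *)
Lemma weighted_hoelder (f g q : lebR R -> R) :
  L0 I f -> L0 I g -> L0 I q ->
  (forall t : R, 0 < t -> rearr leb I f t \is a fin_num) ->
  (forall t : R, 0 < t -> rearr leb I g t \is a fin_num) ->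
  (forall t, I t -> leb_star g t = q t * w t) ->
  (forall t : R, 0 < t -> rearr nu I (leb_star f) t \is a fin_num) ->
  (forall t : R, 0 < t -> rearr nu I q t \is a fin_num) ->
  (\int[leb]_(x in I) `|f x * g x|%:E <=
   \int[leb]_(x in J) `|wt_star (leb_star f) x * wt_star q x|%:E)%E.
Proof.
move=> mf mg mq ffin gfin gq Ffin qfin.
have mF : L0 I (leb_star f) by exact: leb_star_L0.
have mG : L0 I (leb_star g) by exact: leb_star_L0.
apply: le_trans (hardy_littlewood_leb mI mf mg) _.
rewrite (@eq_overlap _ _ (distribution leb I (leb_star f))
                     _ (distribution leb I (leb_star g)));
  try by move=> s s0; rewrite leb_star_dist.
have ni_leb h : (forall t : R, 0 < t -> rearr leb I h t \is a fin_num) ->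
    forall x y : R, I x -> I y -> x <= y -> leb_star h y <= leb_star h x.
  by move=> hfin x y /I_gt0 x0 /I_gt0 y0; exact: fine_rearr_nonincreasing.
rewrite -(integral_overlap_leb mI mF mG); last first.
  by apply: nonincreasing_nested; try exact: ni_leb; move=> x _; exact: fine_rearr_ge0.
rewrite (_ : (\int[leb]_(x in I) `|leb_star f x * leb_star g x|%:E)%E =
  (\int[leb]_(x in I) (`|leb_star f x| * (`|q x| * w x))%:E)%E); last first.
  apply: eq_integral => x; rewrite inE => Ix.
  by rewrite normrM gq// [in LHS]normrM (ger0_norm (w_ge0 Ix)).
(* The quotient q of g^# by w need not be monotone, so only an inequality is available here. *)
apply: le_trans (hardy_littlewood mI mF mq mw w_ge0) _.
rewrite (@eq_overlap _ _ (distribution leb J (wt_star (leb_star f)))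
                     _ (distribution leb J (wt_star q)));
  try by move=> s s0; rewrite wt_star_dist.
rewrite -integral_overlap_leb//.
- exact: L0_fine_rearr.
- exact: L0_fine_rearr.
by apply: nonincreasing_nested; try (by move=> x _; exact: fine_rearr_ge0);
  move=> x y [x0 _] [y0 _]; exact: fine_rearr_nonincreasing.
Qed.

(* The extremal decreasing function attached to [h]: its quotient by [w] is
   [h^* \o W], whose rearrangement with respect to [w dm] is [h^*]. *)
Definition extremal (h : lebR R -> R) (x : lebR R) : R :=
  fine (rearr leb J h (fine (primitive a nu x))) * w x.

Section extremal.
Context (h : lebR R -> R) (mh : L0 J h).
Context (hfin : forall t : R, 0 < t -> rearr leb J h t \is a fin_num).

Let W (x : lebR R) : R := fine (primitive a nu x).
Let hW (x : lebR R) : R := fine (rearr leb J h (W x)).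

Let W_gt0 x : I x -> 0 < W x.
Proof.
move=> Ix; rewrite fine_gt0// (primitive_gt0 w_gt0 w_decr nuE)//=.
exact: (primitive_fin W_fin nuE).
Qed.

Let hW_gt s x : I x -> 0 <= s ->
  (s < hW x) = (primitive a nu x < distribution leb J h s)%E.
Proof.
move=> Ix s0; rewrite -lte_fin fineK; last exact/hfin/W_gt0.
rewrite rearr_gt// fineK//; rewrite ge0_fin_numE; last exact: measure_ge0.
exact: (primitive_fin W_fin nuE).
Qed.

Let hW_ge0 x : 0 <= hW x. Proof. exact: fine_rearr_ge0. Qed.

Let W_nd (x y : R) : I x -> I y -> x <= y -> W x <= W y.
Proof.
move=> Ix Iy xy; rewrite fine_le//.
- by rewrite ge0_fin_numE; [exact: (primitive_fin W_fin nuE)|exact: measure_ge0].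
- by rewrite ge0_fin_numE; [exact: (primitive_fin W_fin nuE)|exact: measure_ge0].
apply: (@upper_mass_ni _ (lebR R) R nu (itv0 a) (fun x : R => - x)).
- exact: mI.
- by apply: measurable_funTS; apply: borel_lebR_measurable_fun; exact: oppr_measurable.
- by rewrite lerN2.
Qed.

Let hW_ni (x y : R) : I x -> I y -> x <= y -> hW y <= hW x.
Proof.
move=> Ix Iy xy; apply: fine_rearr_nonincreasing => //.
- exact: W_gt0.
- exact: W_gt0.
- exact: W_nd.
Qed.

Lemma extremal_ge0 x : I x -> 0 <= extremal h x.
Proof. by move=> Ix; rewrite mulr_ge0// ?w_ge0//; exact: hW_ge0. Qed.

Lemma extremal_ni (x y : R) : I x -> I y -> x <= y -> extremal h y <= extremal h x.
Proof.
move=> Ix Iy xy; apply: ler_pM; [exact: hW_ge0|exact: w_ge0|exact: hW_ni|exact: w_decr].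
Qed.

Lemma extremal_L0 : L0 I (extremal h).
Proof.
apply: nonincreasing_lebR_measurable; first exact: is_interval_itv0.
exact: extremal_ni.
Qed.

(** The extremal function k decreases, so it can exceed k(x) only to the left of x. This gives k^#
    <= k, and a level at which d_k is finite. *)
Lemma extremal_dist_le (x : R) : I x ->
  (distribution leb I (extremal h) (extremal h x) <= x%:E)%E.
Proof.
move=> Ix; have x0 := I_gt0 Ix.
apply: (@le_trans _ _ (leb (itv0 x%:E))); last by rewrite leb_itv0// lee_fin ltW.
apply: le_measure; rewrite ?inE.
- by apply: measurable_abs_gt => //; exact: extremal_L0.
- exact: measurable_itv0.
move=> y [Iy /=]; rewrite ger0_norm ?extremal_ge0// => kxy.
split; first exact: I_gt0.
rewrite lte_fin ltNge; apply/negP => xy.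
by have := lt_le_trans kxy (extremal_ni Ix Iy xy); rewrite ltxx.
Qed.

Lemma rearr_extremal_le (x : R) : I x ->
  (rearr leb I (extremal h) x <= (extremal h x)%:E)%E.
Proof.
move=> Ix; rewrite leNgt; apply/negP; rewrite rearr_gt//.
- by rewrite ltNge extremal_dist_le.
- exact: extremal_L0.
- exact: extremal_ge0.
Qed.

(** h^#(W(x)) > s means W(x) < d_h(s), and the points with this property have weighted mass
    min(d_h(s), b) = d_h(s). *)
Lemma distribution_hW s : 0 <= s ->
  distribution (wmeas w) I hW s = distribution leb J h s.
Proof.
move=> s0; rewrite dist_wmeas /distribution -/(distribution leb J h s).
rewrite (_ : I `&` _ = I `&` [set x | (primitive a nu x < distribution leb J h s)%E]).
  rewrite (mass_primitive_lt w_decr W_fin b_def nuE); last exact: measure_ge0.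
  apply/min_idPl; rewrite -lebJ; apply: le_measure; rewrite ?inE//.
  exact: measurable_abs_gt.
apply/seteqP; split => x [Ix /=].
  by rewrite ger0_norm// hW_gt.
by rewrite -hW_gt// => sx; split => //=; rewrite ger0_norm.
Qed.

Lemma distribution_quotient_le (q : lebR R -> R) (s : R) : 0 <= s -> L0 I q ->
  (forall x, I x -> `|q x| * w x <= extremal h x) ->
  (distribution (wmeas w) I q s <= distribution leb J h s)%E.
Proof.
move=> s0 mq qk; rewrite -distribution_hW// !dist_wmeas.
apply: le_measure; rewrite ?inE; try exact: measurable_abs_gt.
  apply: measurable_abs_gt => //; apply: nonincreasing_lebR_measurable.
    exact: is_interval_itv0.
  exact: hW_ni.
move=> x [Ix /= sx]; split => //=; apply: (lt_le_trans sx).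
by rewrite (ger0_norm (hW_ge0 x)) -(ler_pM2r (w_gt0 Ix)); exact: qk.
Qed.

Lemma extremal_gt0 (s x : R) : I x -> 0 <= s ->
  (primitive a nu x < distribution leb J h s)%E -> 0 < extremal h x.
Proof.
move=> Ix s0; rewrite -hW_gt// => sx; apply: mulr_gt0; last exact: w_gt0.
exact: le_lt_trans sx.
Qed.

(** Hardy-Littlewood on J is the only inequality. The overlap it produces equals the integral of f^#
    k over I, because f^# and h^# composed with W both decrease, and f^# and k both decrease as
    well. *)
Lemma overlap_extremal (f : lebR R -> R) : L0 I f ->
  (forall t : R, 0 < t -> rearr leb I f t \is a fin_num) ->
  (forall t : R, 0 < t -> rearr nu I (leb_star f) t \is a fin_num) ->
  (\int[leb]_(x in J) `|wt_star (leb_star f) x * h x|%:E <=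
   overlap (distribution leb I f) (distribution leb I (extremal h)))%E.
Proof.
move=> mf ffin Ffin.
have mF : L0 I (leb_star f) by exact: leb_star_L0.
have mhW : L0 I hW.
  by apply: nonincreasing_lebR_measurable; [exact: is_interval_itv0|exact: hW_ni].
have Fni (x y : R) : I x -> I y -> x <= y -> leb_star f y <= leb_star f x.
  by move=> /I_gt0 x0 /I_gt0 y0; exact: fine_rearr_nonincreasing.
have F0 x : 0 <= leb_star f x by exact: fine_rearr_ge0.
apply: (@le_trans _ _ (overlap (distribution leb J (wt_star (leb_star f)))
                               (distribution leb J h))).
  by apply: hardy_littlewood_leb => //; exact: L0_fine_rearr.
rewrite (@eq_overlap _ _ (distribution (wmeas w) I (leb_star f))
                     _ (distribution (wmeas w) I hW)).
- rewrite -(integral_overlap mI mF mhW mw w_ge0); last first.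
    by apply: nonincreasing_nested => //; exact: hW_ni.
  rewrite (_ : (\int[leb]_(x in I) (`|leb_star f x| * (`|hW x| * w x))%:E)%E =
    (\int[leb]_(x in I) `|leb_star f x * extremal h x|%:E)%E); last first.
    apply: eq_integral => x; rewrite inE => Ix.
    by rewrite [in RHS]normrM [in RHS]normrM (ger0_norm (w_ge0 Ix)).
  rewrite (integral_overlap_leb mI mF extremal_L0); last first.
    apply: nonincreasing_nested => //; [exact: extremal_ge0|exact: extremal_ni].
  rewrite le_eqVlt; apply/orP; left; apply/eqP; apply: eq_overlap => // s s0.
  by rewrite leb_star_dist.
- by move=> s s0; rewrite wt_star_dist.
- by move=> s s0; rewrite distribution_hW// ltW.
Qed.

End extremal.
End duality.

(** * The two inclusions *)

Section theorem_data.
Context (R : realType) (a b : \bar R) (w : lebR R -> R) (E : fclass (itv0 b)).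
Context (a_gt0 : (0 < a)%E)
  (w_gt0 : forall t, itv0 a t -> 0 < w t)
  (w_decr : forall s t : R, itv0 a s -> itv0 a t -> s <= t -> w t <= w s)
  (W_fin : forall t : R, itv0 a t ->
    (\int[leb]_(s in `]0%R, t[) (w s)%:E < +oo)%E)
  (b_def : b = (\int[leb]_(t in itv0 a) (w t)%:E)%E)
  (E_banach : banach_function_space E)
  (E_symm : fully_symmetric E)
  (E_supp : has_support E).
Context (nu : {measure set (lebR R) -> \bar R})
  (nuE : forall A : set (lebR R), A `<=` itv0 a -> nu A = wmeas w A).

Let I : set (lebR R) := itv0 a.
Let J : set (lebR R) := itv0 b.
Let mI : measurable I. Proof. exact: measurable_itv0. Qed.
Let mJ : measurable J. Proof. exact: measurable_itv0. Qed.
Let b0 : (0 < b)%E. Proof. exact: (b_gt0 a_gt0 w_gt0 w_decr b_def nuE). Qed.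
Let mw : L0 I w. Proof. exact: (weight_L0 w_decr). Qed.
Let I_gt0 (x : R) : I x -> 0 < x. Proof. by case. Qed.

Let quot (g : lebR R -> R) (t : lebR R) : \bar R :=
  (rearr leb I g t * ((w t)^-1)%:E)%E.

Let rearrE (f : lebR R -> R) : rearr (wmeas w) I f = rearr nu I f.
Proof. exact: (rearr_wmeas nuE). Qed.

Let fine_quot (g : lebR R -> R) t : I t -> rearr leb I g t \is a fin_num ->
  fine (quot g t) = leb_star a g t / w t.
Proof. by move=> It gt; rewrite fineM. Qed.

Lemma Lorentz_le_kothe (f : lebR R -> R) :
  carrier (Lorentz_space I (kothe_dual E) w) f ->
  L0 I f /\ (kothe_gauge (Mclass I E w) f <=
             gauge (Lorentz_space I (kothe_dual E) w) f)%E.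
Proof.
rewrite /= /ext_mem/= /ext_mem/= => -[mf [ae1 [mF [ae2 [mFF gF]]]]]; split => //.
have [t0 It0 ft0] := ae_itv0_exists a_gt0 ae1.
have ffin := rearr_fin_num_transfer mI mf ft0.
rewrite /ext_gauge/= /ext_gauge/=; move: ae2 mFF gF; rewrite !rearrE => ae2 mFF gF.
have [t1 Jt1 Ft1] := ae_itv0_exists b0 ae2.
have Ffin := rearr_fin_num_transfer mI mF Ft1.
apply: ge_ereal_sup => _ [g [[mg [ae3 [mq [ae4 Eq]]]] gq] <-].
have [t2 It2 gt2] := ae_itv0_exists a_gt0 ae3.
have gfin : forall t : R, 0 < t -> rearr leb I g t \is a fin_num.
  apply: (rearr_fin_num_transfer mI mg (t := t2)).
  (* Only the quotient by w is known to be finite; an infinite g^# would stay infinite after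
     multiplication by 1/w > 0. *)
  move: gt2; have := rearr_ge0 leb I g t2.
  case: (rearr leb I g t2) => //= _.
  by rewrite gt0_mulye// lte_fin invr_gt0; exact: w_gt0.
have [t3 Jt3] := ae_itv0_exists b0 ae4; rewrite rearrE => qt3.
have qfin := rearr_fin_num_transfer mI mq qt3.
apply: (le_trans (weighted_hoelder a_gt0 w_gt0 w_decr b_def nuE mf mg mq
                    ffin gfin _ Ffin qfin)).
  move=> t It; rewrite /= fine_quot//; last by apply: gfin; exact: I_gt0.
  by rewrite divfK// gt_eqF// w_gt0.
apply: ereal_sup_ubound; exists (wt_star a nu (fine \o quot g)) => //; split.
  by move: Eq; rewrite /= rearrE.
by move: gq; rewrite /= /ext_gauge/= /ext_gauge/= rearrE.
Qed.

Let inv_w_L0 : L0 I (fun t => (w t)^-1).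
Proof.
(* 1/w increases, so measurability is obtained for the decreasing function -1/w. *)
rewrite (_ : (fun t => _) = (fun t => -1 * - (w t)^-1)); last first.
  by apply/funext => t; rewrite mulN1r opprK.
apply: (@L0_mul R I (fun=> -1) (fun t => - (w t)^-1)); first exact: measurable_cst.
apply: nonincreasing_lebR_measurable; first exact: is_interval_itv0.
move=> x y Ix Iy xy; rewrite lerN2 lef_pV2 ?posrE ?w_gt0//.
exact: w_decr.
Qed.

(** From g^# <= k^# <= k one gets g^# / w <= h^# composed with W, pointwise on I. The weighted
    rearrangement of the quotient is then at most h^#, whose norm is at most that of h. *)
Lemma Mclass_dominated (g h : lebR R -> R) :
  carrier E h -> (gauge E h <= 1)%E -> L0 I g ->
  (forall u, 0 < u -> (distribution leb I g u <=
    distribution leb I (extremal a b w nu h) u)%E) ->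
  carrier (Mclass I E w) g /\ (gauge (Mclass I E w) g <= 1)%E.
Proof.
move=> Eh h1 mg gk.
have mh : L0 J h := bfs_L0 E_banach Eh.
have hfin t : 0 < t -> rearr leb J h t \is a fin_num.
  by move=> t0; exact: (carrier_rearr_fin_num E_banach E_symm Eh).
have kI x : I x ->
    (rearr leb I (extremal a b w nu h) x <= (extremal a b w nu h x)%:E)%E.
  exact: (rearr_extremal_le w_gt0 w_decr W_fin nuE hfin).
have gk' x : I x -> (rearr leb I g x <= (extremal a b w nu h x)%:E)%E.
  by move=> Ix; apply: le_trans (kI x Ix); exact: le_rearr.
have [x0 Ix0] := itv0_nonempty a_gt0.
have gfin : forall t : R, 0 < t -> rearr leb I g t \is a fin_num.
  apply: (rearr_fin_num_transfer mI mg (t := x0)).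
  rewrite ge0_fin_numE; last exact: rearr_ge0.
  by apply: le_lt_trans (gk' _ Ix0) _; exact: ltry.
have mG : L0 I (leb_star a g) by exact: L0_fine_rearr.
have mq : L0 I (fine \o quot g).
  apply: (eq_measurable_fun (fun t => leb_star a g t * (w t)^-1)).
    by move=> t; rewrite inE => It; rewrite /= fine_quot//; apply: gfin; exact: I_gt0.
  exact: L0_mul.
have qk t : I t -> `|(fine \o quot g) t| * w t <= extremal a b w nu h t.
  move=> It; have gt : rearr leb I g t \is a fin_num by apply: gfin; exact: I_gt0.
  rewrite /= fine_quot// ger0_norm; last first.
    by rewrite divr_ge0 ?fine_rearr_ge0// ltW// w_gt0.
  by rewrite divfK ?gt_eqF ?w_gt0// -lee_fin fineK//; exact: gk'.
have qh t : (rearr nu I (fine \o quot g) t <= rearr leb J h t)%E.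
  rewrite -rearrE; apply: le_rearr => s s0.
  exact: (distribution_quotient_le a_gt0 w_gt0 w_decr W_fin b_def nuE mh hfin
            (ltW s0) mq qk).
have qfin t : 0 < t -> rearr nu I (fine \o quot g) t \is a fin_num.
  move=> t0; rewrite ge0_fin_numE; last exact: rearr_ge0.
  apply: le_lt_trans (qh t) _; rewrite -ge0_fin_numE; last exact: rearr_ge0.
  exact: hfin.
have [Ehs hs1] := carrier_fine_rearr E_banach E_symm b0 Eh.
have [|Eq q1] := carrier_le E_banach (L0_fine_rearr qfin) Ehs.
  move=> t [t0 _]; rewrite !ger0_norm ?fine_rearr_ge0//.
  by apply: fine_le; [exact: qfin|exact: hfin|exact: qh].
split; last first.
  rewrite /= /ext_gauge/= /ext_gauge/= rearrE.
  exact: (le_trans q1 (le_trans hs1 h1)).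
split => //; split.
  apply: aeW => t It; rewrite fin_numM//; apply: gfin; exact: I_gt0.
split => //; split; last by rewrite rearrE.
by apply: aeW => t [t0 _]; rewrite rearrE; exact: qfin.
Qed.

Lemma overlap_le_kothe (f h : lebR R -> R) :
  L0 I f -> carrier E h -> (gauge E h <= 1)%E ->
  (overlap (distribution leb I f) (distribution leb I (extremal a b w nu h)) <=
   kothe_gauge (Mclass I E w) f)%E.
Proof.
move=> mf Eh h1.
have hfin t : 0 < t -> rearr leb J h t \is a fin_num.
  by move=> t0; exact: (carrier_rearr_fin_num E_banach E_symm Eh).
have [x0 Ix0] := itv0_nonempty a_gt0.
have kx0 := extremal_dist_le w_gt0 w_decr W_fin nuE hfin Ix0.
apply: (resonance mI _ mf _ (le_lt_trans kx0 (ltry _))).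
- by move=> x; exact: I_gt0.
- exact: (extremal_L0 w_gt0 w_decr W_fin nuE hfin).
move=> g mg gk; have [Mg g1] := Mclass_dominated Eh h1 mg gk.
by apply: ereal_sup_ubound; exists g.
Qed.

(** The support hypothesis enters here, to supply a nonzero test function. The cut at 1 keeps the
    mass finite when b is infinite. *)
Lemma normalized_indicator : exists2 h, carrier E h /\ (gauge E h <= 1)%E &
  exists2 s : R, 0 < s & (0 < distribution leb J h s)%E.
Proof.
pose A : set (lebR R) := itv0 (mine b 1%E).
have m1 : (0 < mine b 1)%E by rewrite lt_min b0 lte_fin ltr01.
have AJ : A `<=` J.
  by move=> x [x0]; rewrite lt_min => /andP[xb _]; split.
have lebA : leb A = mine b 1%E by apply: leb_itv0; exact: ltW.
have EA : carrier E (\1_A : lebR R -> R).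
  apply: E_supp => //; first exact: measurable_itv0.
  by rewrite lebA gt_min ltry orbT.
have /andP[g0 goo] := bfs_norm_fin E_banach EA.
have gfin : gauge E (\1_A : lebR R -> R) \is a fin_num by rewrite ge0_fin_numE.
(* Adding 1 avoids a separate proof that the norm is nonzero. *)
pose c := (fine (gauge E (\1_A : lebR R -> R)) + 1)^-1.
have gr0 : 0 <= fine (gauge E (\1_A : lebR R -> R)) by exact: fine_ge0.
have c0 : 0 < c by rewrite invr_gt0; lra.
exists (fun x => c * \1_A x).
  split; first exact: (bfs_scale E_banach).
  rewrite (bfs_normZ E_banach)// -(fineK gfin) -EFinM lee_fin (gtr0_norm c0).
  by rewrite /c mulrC ler_pdivrMr; lra.
exists (c / 2); first by rewrite divr_gt0.
rewrite /distribution (_ : _ `&` _ = A); first by rewrite lebA.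
apply/seteqP; split => [x [Jx /=]|x Ax].
  rewrite indicE; case: (boolP (x \in A)); first by rewrite inE.
  by rewrite mulr0 normr0 => _; rewrite ltNge divr_ge0// ltW.
split; first exact: AJ.
by rewrite /= indicE mem_set// mulr1 (gtr0_norm c0); lra.
Qed.

(** An infinite value of f^# at a positive argument forces d_f to be infinite at every positive
    level; the overlap with any nonzero extremal function is then infinite, against the finite
    Koethe gauge. *)
Lemma kothe_rearr_fin_num (f : lebR R -> R) : L0 I f ->
  (kothe_gauge (Mclass I E w) f < +oo)%E ->
  forall t : R, 0 < t -> rearr leb I f t \is a fin_num.
Proof.
move=> mf foo.
have [h [Eh h1] [s s0 hs]] := normalized_indicator.
have mh : L0 J h := bfs_L0 E_banach Eh.
have hfin t : 0 < t -> rearr leb J h t \is a fin_num.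
  by move=> t0; exact: (carrier_rearr_fin_num E_banach E_symm Eh).
(* Such points have weighted mass min(d_h(s), b) > 0, so there is one; k is positive there. *)
have [x [Ix hx]] : exists x : R, I x /\ (primitive a nu x < distribution leb J h s)%E.
  apply: contrapT => /forallNP nox.
  have := mass_primitive_lt w_decr W_fin b_def nuE (ltW hs).
  rewrite (_ : _ `&` _ = set0) ?measure0; last first.
    by apply/seteqP; split => // x [Ix hx]; exact: (nox x).
  by move/eqP; rewrite lt_eqF// lt_min hs b0.
have kx := extremal_gt0 w_gt0 w_decr W_fin nuE mh hfin Ix (ltW s0) hx.
set k := extremal a b w nu h in kx.
have kni (y z : R) : I y -> I z -> y <= z -> k z <= k y.
  exact: (extremal_ni w_gt0 w_decr W_fin nuE hfin).
have mk : L0 I k by exact: (extremal_L0 w_gt0 w_decr W_fin nuE hfin).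
have x0 : 0 < x := I_gt0 Ix.
apply: contrapT => /existsNP[t /not_implyP[t0 /negP ft]].
have foo' u : 0 < u -> distribution leb I f u = +oo%E.
  move=> u0; apply/eqP; rewrite -leye_eq leNgt; apply/negP => du.
  by move: ft; rewrite (rearr_fin_num mI mf du t0).
have := overlap_le_kothe mf Eh h1; rewrite -/k.
(* As k decreases, k >= k(x) > k(x)/2 left of x, so d_k at this level is at least x. *)
rewrite (@overlap_infinite _ _ _ (k x / 2) x)//.
- by rewrite leye_eq => /eqP h2; move: foo; rewrite h2.
- by rewrite divr_gt0.
- by move=> u u' _; exact: distribution_ni.
rewrite -[leLHS](leb_itv0 (c := x%:E)); last by rewrite lee_fin ltW.
apply: le_measure; rewrite ?inE.
- exact: measurable_itv0.
- exact: measurable_abs_gt.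
move=> y [y0 yx].
have Iy : I y by split => //; apply: lt_trans yx _; case: Ix.
split => //=; apply: lt_le_trans (ler_norm _).
have : k x <= k y by apply: kni => //; move: yx; rewrite lte_fin => /ltW.
lra.
Qed.

Lemma kothe_le_Lorentz (f : lebR R -> R) :
  carrier (kothe_dual (Mclass I E w)) f ->
  carrier (Lorentz_space I (kothe_dual E) w) f /\
  (gauge (Lorentz_space I (kothe_dual E) w) f <=
   kothe_gauge (Mclass I E w) f)%E.
Proof.
move=> [mf foo]; have ffin := kothe_rearr_fin_num mf foo.
have mF : L0 I (leb_star a f) by exact: L0_fine_rearr.
have Ffin : forall t : R, 0 < t -> rearr nu I (leb_star a f) t \is a fin_num.
  have [x Ix] := itv0_nonempty a_gt0; have x0 := I_gt0 Ix.
  (* f^# exceeds f^#(x) only to the left of x, a set of weighted mass at most W(x), which is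
     finite. *)
  move=> t; apply: (rearr_fin_num mI mF (s := leb_star a f x)).
  apply: le_lt_trans (primitive_fin W_fin nuE Ix).
  rewrite primitiveE; apply: le_measure; rewrite ?inE.
  - exact: measurable_abs_gt.
  - by rewrite itv0_lt//; apply: is_interval_lebR_measurable; exact: interval_is_interval.
  move=> y [Iy /=]; rewrite ger0_norm ?fine_rearr_ge0// => xy; split => //=.
  rewrite ltNge; apply/negP => yx.
  have := fine_rearr_nonincreasing ffin x0 (I_gt0 Iy) yx.
  by rewrite leNgt xy.
have le : (kothe_gauge E (wt_star a nu (leb_star a f)) <=
           kothe_gauge (Mclass I E w) f)%E.
  apply: ge_ereal_sup => _ [h [Eh h1] <-].
  have mh : L0 J h := bfs_L0 E_banach Eh.
  have hfin t : 0 < t -> rearr leb J h t \is a fin_num.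
    by move=> t0; exact: (carrier_rearr_fin_num E_banach E_symm Eh).
  apply: le_trans (overlap_le_kothe mf Eh h1).
  exact: (overlap_extremal a_gt0 w_gt0 w_decr W_fin b_def nuE mh hfin mf ffin Ffin).
split; last by rewrite /= /ext_gauge/= /ext_gauge/= rearrE.
split => //; split.
  by apply: aeW => t It; apply: ffin; exact: I_gt0.
split => //; split.
  by apply: aeW => t [t0 _]; rewrite rearrE; exact: Ffin.
by rewrite rearrE; split; [exact: L0_fine_rearr|exact: le_lt_trans foo].
Qed.

End theorem_data.

Theorem theorem5p1 (R : realType) (a b : \bar R) (w : lebR R -> R)
    (E : fclass (itv0 b))
    (a_gt0 : (0 < a)%E)
    (w_gt0 : forall t, itv0 a t -> 0 < w t)
    (w_decr : forall s t : R, itv0 a s -> itv0 a t -> s <= t -> w t <= w s)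
    (W_fin : forall t : R, itv0 a t ->
      (\int[leb]_(s in `]0%R, t[) (w s)%:E < +oo)%E)
    (b_def : b = (\int[leb]_(t in itv0 a) (w t)%:E)%E)
    (E_banach : banach_function_space E)
    (E_symm : fully_symmetric E)
    (E_supp : has_support E) :
  carrier (kothe_dual (Mclass (itv0 a) E w))
    = carrier (Lorentz_space (itv0 a) (kothe_dual E) w) /\
  (forall f, carrier (kothe_dual (Mclass (itv0 a) E w)) f ->
    gauge (kothe_dual (Mclass (itv0 a) E w)) f
      = gauge (Lorentz_space (itv0 a) (kothe_dual E) w) f).
Proof.
have [nu nuE] := wmeas_measure w_gt0 w_decr.
have toL f := kothe_le_Lorentz a_gt0 w_gt0 w_decr W_fin b_def
                E_banach E_symm E_supp nuE (f := f).
have ofL f := Lorentz_le_kothe a_gt0 w_gt0 w_decr b_def nuE (E := E) (f := f).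
split=> [|f Mf].
  apply/seteqP; split => f; first by case/toL.
  move=> /[dup] Lf /ofL[mf fle]; split => //=; apply: (le_lt_trans fle).
  by case: Lf => _ [_ [_ [_ []]]].
have [Lf le1] := toL f Mf; have [_ le2] := ofL f Lf.
by apply/eqP; rewrite eq_le le1 andbT.
Qed.
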